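(* Let $n\ge 1$, $1<p<\infty$, let $R\subset\mathbb R^{n+1}$ be a parabolic rectangle, and let $0<\gamma<1$, $-1<\rho\le\gamma$, $-\rho<\sigma\le\gamma$ and $0<q\le1$. Assume that $f\in \mathrm{PBMO}^+_{\gamma,q}(R)$ and let $\|f\|=\|f\|_{\mathrm{PBMO}^+_{\gamma,q}(R)}$, with $\|f\|>0$. Then there exist a constant $c\in\mathbb R$ and positive constants $A$, $B$, depending only on $n,p,q,\gamma,\rho,\sigma$, such that \[ |R^{+}(\rho)\cap\{(f-c)_+>\lambda\}|\le A e^{-B(\lambda/\|f\|)^q}\,|R^{+}(\rho)| \] and \[ |R^{-}(\sigma)\cap\{(f-c)_->\lambda\}|\le A e^{-B(\lambda/\|f\|)^q}\,|R^{-}(\sigma)| \] for every $\lambda>0$.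
   Context: Points of $\mathbb R^{n+1}$ are written $(x,t)$ with $x\in\mathbb R^n$, $t\in\mathbb R$; $|E|$ is Lebesgue measure, integrals are with respect to $dx\,dt$, and $⨍_E g=\frac1{|E|}\int_E g$ denotes the integral average. Write $g_+=\max\{g,0\}$, $g_-=-\min\{g,0\}$. For $x\in\mathbb R^n$ and $L>0$ let $Q(x,L)=\{y\in\mathbb R^n:|y_i-x_i|\le L,\ i=1,\dots,n\}$. A parabolic rectangle (in the $p$-geometry, $1<p<\infty$ fixed) centered at $(x,t)$ with side length $L>0$ is $R=R(x,t,L)=Q(x,L)\times(t-L^p,t+L^p)$. For $-1<\gamma<1$ its upper and lower parts are $R^+(\gamma)=Q(x,L)\times(t+\gamma L^p,t+L^p)$ and $R^-(\gamma)=Q(x,L)\times(t-L^p,t-\gamma L^p)$. For a parabolic rectangle $R$, $0\le\gamma<1$ and $0<q<\infty$, a function $f\in L^q_{\mathrm{loc}}(R)$ belongs to $\mathrm{PBMO}^+_{\gamma,q}(R)$ if \[ \|f\|_{\mathrm{PBMO}^+_{\gamma,q}(R)}=\sup_{P\subset R}\ \inf_{c\in\mathbb R}\Big(⨍_{P^+(\gamma)}(f-c)_+^q+⨍_{P^-(\gamma)}(f-c)_-^q\Big)^{1/q}<\infty, \] where the supremum is over all parabolic rectangles $P\subset R$ (including $R$ itself). *)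

(* Defs.v *)
From HB Require Import structures.
From mathcomp Require Import all_boot all_order all_algebra.
From mathcomp Require Import all_classical all_reals all_analysis.

Set Implicit Arguments.
Unset Strict Implicit.
Unset Printing Implicit Defensive.

Import Order.TTheory GRing.Theory Num.Theory.
Import numFieldNormedType.Exports.

Local Open Scope classical_set_scope.
Local Open Scope ring_scope.

(* The Borel sigma-algebra of R^n, generated by the coordinate functions. *)
Section measurable_row.
Context {R : realType} (n : nat).

Let coor (i : 'I_n) (x : 'rV[R]_n) : R := x ord0 i.

Let row_set0 : g_sigma_preimage coor set0.
Proof. exact: sigma_algebra0. Qed.

Let row_setC A : g_sigma_preimage coor A -> g_sigma_preimage coor (~` A).
Proof. exact: sigma_algebraC. Qed.

Let row_bigcup (F : (set 'rV[R]_n)^nat) :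
  (forall i, g_sigma_preimage coor (F i)) ->
  g_sigma_preimage coor (\bigcup_i F i).
Proof. exact: sigma_algebra_bigcup. Qed.

HB.instance Definition _ := @isMeasurable.Build default_measure_display
  'rV[R]_n (g_sigma_preimage coor) row_set0 row_setC row_bigcup.

Lemma measurable_coor (i : 'I_n) :
  measurable_fun [set: 'rV[R]_n] (fun x : 'rV[R]_n => x ord0 i).
Proof.
move=> _ Y mY; rewrite setTI; apply: sub_sigma_algebra => /=.
rewrite -bigcup_seq/=; exists i => /=; first by rewrite mem_index_enum.
by exists Y => //; rewrite setTI.
Qed.

Lemma measurable_fun_rowP d (T : measurableType d) (f : T -> 'rV[R]_n) :
  (forall i, measurable_fun [set: T] (fun z => f z ord0 i)) ->
  measurable_fun [set: T] f.
Proof.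
move=> mf; suff H : g_sigma_preimage (fun i => coor i \o f) `<=` measurable.
  move=> _ A mA; apply: H; rewrite g_sigma_preimage_comp.
  by exists A.
apply: smallest_sub; first exact: sigma_algebra_measurable.
rewrite -bigcup_seq; apply: bigcup_sub => i _ A [B mB <-].
exact: mf.
Qed.

End measurable_row.

Section row_cons.
Context {R : realType} (n : nat).

Definition row_cons (z : R * 'rV[R]_n) : 'rV[R]_n.+1 :=
  \row_i (if unlift ord0 i is Some j then z.2 ord0 j else z.1).

Lemma measurable_row_cons : measurable_fun [set: R * 'rV[R]_n] row_cons.
Proof.
apply: measurable_fun_rowP => i.
under eq_fun do rewrite mxE.
case: (unlift ord0 i) => [j|]; last exact: measurable_fst.
apply: (@measurableT_comp _ _ _ _ _ _ (fun x : 'rV[R]_n => x ord0 j)).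
  exact: measurable_coor.
exact: measurable_snd.
Qed.

End row_cons.

(* Lebesgue measure on the Borel sets of R^n, by induction on n via
   R^(n+1) = R x R^n; see lebesgue_row_box for its value on boxes. *)
Fixpoint lebesgue_row {R : realType} (n : nat) : set 'rV[R]_n -> \bar R :=
  match n with
  | 0 => \d_(0 : 'rV[R]_0)
  | m.+1 => pushforward (lebesgue_measure \x @lebesgue_row R m)%E
      (@row_cons R m : (measurableTypeR R * 'rV[R]_m)%type -> 'rV[R]_m.+1)
  end.
Arguments lebesgue_row {R} n.

Section lebesgue_cons.
Context {R : realType} (n : nat).
Variable m : {sigma_finite_measure set 'rV[R]_n -> \bar R}.
Local Open Scope ereal_scope.

Let product := (measurableTypeR R * 'rV[R]_n)%type.

Definition lebesgue_cons : set 'rV[R]_n.+1 -> \bar R :=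
  pushforward (lebesgue_measure \x m) (@row_cons R n : product -> 'rV[R]_n.+1).

Let mcons : measurable_fun [set: product] (@row_cons R n).
Proof. exact: measurable_row_cons. Qed.

Let lebesgue_cons0 : lebesgue_cons set0 = 0.
Proof. by rewrite /lebesgue_cons /pushforward preimage_set0 measure0. Qed.

Let lebesgue_cons_ge0 A : 0 <= lebesgue_cons A.
Proof. exact: measure_ge0. Qed.

Let lebesgue_cons_sigma_additive : semi_sigma_additive lebesgue_cons.
Proof.
exact: (@measure_semi_sigma_additive _ _ _
  (measure_function_pushforward__canonical__measure_function_Measure
     (lebesgue_measure \x m) mcons)).
Qed.

HB.instance Definition _ := isMeasure.Build _ _ _ lebesgue_cons
  lebesgue_cons0 lebesgue_cons_ge0 lebesgue_cons_sigma_additive.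

Let uncons (x : 'rV[R]_n.+1) : product :=
  (x ord0 ord0, \row_j x ord0 (lift ord0 j)).

Let muncons : measurable_fun [set: 'rV[R]_n.+1] uncons.
Proof.
apply/measurable_fun_pairP; split; first exact: measurable_coor.
apply: measurable_fun_rowP => i /=.
by under eq_fun do rewrite mxE; exact: measurable_coor.
Qed.

Let row_consK : cancel (@row_cons R n) uncons.
Proof.
move=> [a x]; congr (_, _); first by rewrite mxE unlift_none.
by apply/rowP => j; rewrite !mxE liftK.
Qed.

Let lebesgue_cons_sigma_finite : sigma_finite setT lebesgue_cons.
Proof.
have /sigma_finiteP[F [FT ndF Foo]] := sigma_finiteT (@lebesgue_measure R).
have /sigma_finiteP[G [GT ndG Goo]] := sigma_finiteT m.
exists (fun k => uncons @^-1` (F k `*` G k)).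
  apply/esym; rewrite -subTset => x _.
  have : (\bigcup_k F k) (uncons x).1 by rewrite -FT.
  have : (\bigcup_k G k) (uncons x).2 by rewrite -GT.
  move=> [j _ Gj] [i _ Fi]; exists (maxn i j) => //; split.
    by move: Fi; apply/subsetPset/ndF/leq_maxl.
  by move: Gj; apply/subsetPset/ndG/leq_maxr.
move=> k; have [mF F_oo] := Foo k; have [mG G_oo] := Goo k.
have mFG : measurable (F k `*` G k : set product) by exact: measurableX.
split; first by rewrite -[X in measurable X]setTI; exact: muncons.
rewrite /lebesgue_cons /pushforward -comp_preimage.
rewrite (_ : _ \o _ = id); last by apply/funext => z; exact: row_consK.
by rewrite preimage_id product_measure1E// lte_mul_pinfty// ge0_fin_numE.
Qed.

HB.instance Definition _ := Measure_isSigmaFinite.Build _ _ _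
  lebesgue_cons lebesgue_cons_sigma_finite.

End lebesgue_cons.

Section lebesgue_row_measure.
Context {R : realType}.
Local Open Scope ereal_scope.

Lemma lebesgue_row_is_measure n :
  exists m : {sigma_finite_measure set 'rV[R]_n -> \bar R},
    m = lebesgue_row n :> (set _ -> _).
Proof.
elim: n => [|n [m mE]]; first by exists (dirac (0%R : 'rV[R]_0)).
by exists (lebesgue_cons m) => /=; rewrite -mE.
Qed.

Variable n : nat.

Let lebesgue_row0 : lebesgue_row n (set0 : set 'rV[R]_n) = 0.
Proof. by have [m <-] := lebesgue_row_is_measure n; exact: measure0. Qed.

Let lebesgue_row_ge0 (A : set 'rV[R]_n) : 0 <= lebesgue_row n A.
Proof. by have [m <-] := lebesgue_row_is_measure n; exact: measure_ge0. Qed.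

Let lebesgue_row_sigma_additive :
  semi_sigma_additive (lebesgue_row n : set 'rV[R]_n -> _).
Proof.
by have [m <-] := lebesgue_row_is_measure n; exact: measure_semi_sigma_additive.
Qed.

HB.instance Definition _ := isMeasure.Build _ _ _ (@lebesgue_row R n)
  lebesgue_row0 lebesgue_row_ge0 lebesgue_row_sigma_additive.

Let lebesgue_row_sigma_finite :
  sigma_finite setT (lebesgue_row n : set 'rV[R]_n -> _).
Proof. by have [m <-] := lebesgue_row_is_measure n; exact: sigma_finiteT. Qed.

HB.instance Definition _ := Measure_isSigmaFinite.Build _ _ _
  (@lebesgue_row R n) lebesgue_row_sigma_finite.

End lebesgue_row_measure.

Section lebesgue_row_box.
Context {R : realType}.
Local Open Scope ereal_scope.

Lemma measurable_row_box n (A : 'I_n -> set R) :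
  (forall i, measurable (A i)) ->
  measurable [set x : 'rV[R]_n | forall i, A i (x ord0 i)].
Proof.
move=> mA; rewrite (_ : [set _ | _] =
    \bigcap_(i in [set: 'I_n]) ((fun x : 'rV[R]_n => x ord0 i) @^-1` A i)).
  apply: fin_bigcap_measurable; first exact: finite_finset.
  by move=> i _; rewrite -[X in measurable X]setTI; exact: measurable_coor.
by apply/seteqP; split => x /= xA i; [move=> _; exact: xA|exact: xA].
Qed.

Lemma lebesgue_row_box n (A : 'I_n -> set R) :
  (forall i, measurable (A i)) ->
  lebesgue_row n [set x : 'rV[R]_n | forall i, A i (x ord0 i)] =
  \prod_(i < n) lebesgue_measure (A i).
Proof.
elim: n A => [|n IH] A mA.
  by rewrite big_ord0 /= diracE mem_set// => -[].
have mB := measurable_row_box (fun i => mA (lift ord0 i)).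
rewrite big_ord_recl -IH; last by move=> i; exact: mA.
rewrite /= /pushforward -product_measure1E//; last exact: mA.
congr (product_measure1 _ _ _); apply/seteqP; split => -[a x] /=.
- move=> xA; split; first by have := xA ord0; rewrite mxE unlift_none.
  by move=> i; have := xA (lift ord0 i); rewrite mxE liftK.
- by move=> [aA xA] i; rewrite mxE; case: unliftP => [j ->|->].
Qed.

End lebesgue_row_box.

(* Lebesgue measure on R^n x R, defined on the sigma-algebra of Lebesgue
   measurable sets: this is the completion of the product measure (the library
   measure lebesgue_measure only lives on the Borel sigma-algebra). *)
Definition lebesgue_spacetime {R : realType} {n : nat} :=
  @completed_measure_extension _ _ _ (lebesgue_row n \x @lebesgue_measure R)%E.
HB.instance Definition _ (R : realType) n :=
  Measure.on (@lebesgue_spacetime R n).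

(* R^n x R equipped with the sigma-algebra of Lebesgue measurable sets. *)
Definition spacetime (R : realType) (n : nat) : measurableType _ :=
  caratheodory_type (lebesgue_row n \x @lebesgue_measure R)^*%mu%E.

Lemma lebesgue_spacetimeX {R : realType} n (A : set 'rV[R]_n) (B : set R) :
  measurable A -> measurable B ->
  lebesgue_spacetime (A `*` B) = (lebesgue_row n A * lebesgue_measure B)%E.
Proof.
move=> mA mB; rewrite -product_measure1E//.
by rewrite /lebesgue_spacetime/= /completed_measure_extension
  measurable_mu_extE//; exact: measurableX.
Qed.

Section parabolic_BMO.
Context {R : realType} {n : nat}.
Local Notation mu := (@lebesgue_spacetime R n).
Implicit Types (x : 'rV[R]_n) (t L p q g : R) (E : set ('rV[R]_n * R))
  (f : 'rV[R]_n * R -> R).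

Definition cube x L : set 'rV[R]_n :=
  [set y | forall i, `|y ord0 i - x ord0 i| <= L].

(* The parabolic rectangle R(x, t, L), for L > 0, and its parts
   R^+(g) and R^-(g). *)
Definition prect p x t L : set ('rV[R]_n * R) :=
  cube x L `*` `]t - L `^ p, t + L `^ p[.

Definition prect_upper p g x t L : set ('rV[R]_n * R) :=
  cube x L `*` `]t + g * L `^ p, t + L `^ p[.

Definition prect_lower p g x t L : set ('rV[R]_n * R) :=
  cube x L `*` `]t - L `^ p, t - g * L `^ p[.

Definition average E (h : 'rV[R]_n * R -> R) : \bar R :=
  ((fine (mu E))^-1%:E * \int[mu]_(z in E) (h z)%:E)%E.

Definition Lq_loc q E f :=
  measurable_fun (E : set (spacetime R n)) (f : spacetime R n -> R) /\
  forall K : set ('rV[R]_n * R), K `<=` E -> compact K ->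
    (\int[mu]_(z in K) (`|f z| `^ q)%:E < +oo)%E.

Definition PBMO_osc p g q f y s l (c : R) : \bar R :=
  let up := average (prect_upper p g y s l) (fun z => (f \- cst c)^\+ z `^ q) in
  let lo := average (prect_lower p g y s l) (fun z => (f \- cst c)^\- z `^ q) in
  ((up + lo) `^ q^-1)%E.

(* The supremum ranges over the centers (r.1.1, r.1.2) and the side lengths r.2
   of the parabolic rectangles included in E. *)
Definition PBMO_norm p g q E f : \bar R :=
  ereal_sup [set ereal_inf (range (PBMO_osc p g q f r.1.1 r.1.2 r.2)) |
    r in [set r : 'rV[R]_n * R * R |
      0 < r.2 /\ prect p r.1.1 r.1.2 r.2 `<=` E]].

Definition PBMO p g q E f :=
  Lq_loc q E f /\ (PBMO_norm p g q E f < +oo)%E.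

End parabolic_BMO.

(* Main.v *)
(* Chebyshev's inequality turns the PBMO condition into: every parabolic rectangle
   P in R has a constant c_P such that f > c_P + K on a fraction at most eps of
   P^+ and f < c_P - K on a fraction at most eps of P^-, with K comparable to the
   norm. A stopping-time argument (Vitali covering and Lebesgue density, no
   integrals) then shows that {f > c_P + lambda} decays exponentially on a part of
   P^+ lying further from P^-. Finally R^+(rho) and R^-(sigma) are covered by such
   parts of rectangles of a fixed small size, and chains of overlapping rectangles
   show that the constants of the latter dominate those of the former up to a
   multiple of K; the supremum of the constants above R^+(rho) is the c of the
   theorem. This gives decay in lambda itself, which is stronger than in
   lambda^q as q <= 1. *)
Require Import Defs.
From mathcomp Require Import all_boot all_order all_algebra.
From mathcomp Require Import all_classical all_reals all_analysis.
From mathcomp Require Import measurable_realfun ring lra.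
Import Order.TTheory GRing.Theory Num.Theory.
Import numFieldNormedType.Exports.
Local Open Scope classical_set_scope.
Local Open Scope ring_scope.

(** * A Vitali covering lemma *)

Section vitali.
Context d (T : measurableType d) (R : realType) (mu : {measure set T -> \bar R}).
Local Open Scope ereal_scope.

(** Halving the side of a parabolic rectangle divides its duration by 2^p, in general not an
    integer, so there is no dyadic subdivision to stop on; a Vitali selection ordered by stopping
    level replaces it. Moreover the rectangles attached to a point must not leave R, so they cannot
    be centered at it: they are clamped against the sides and the top of R, and the point is kept in
    a thin strip below their final time. The constants c_P are picked separately for each P, and a
    large one says nothing about f at a given point. Through the bound on P^-, it does say that f is
    large on most of P^-; where P^- overlaps the upper part of a rectangle with a smaller constant,
    this is a rare event. That pairing of the two bounds drives both the stopping argument and the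
    chains. With gamma = 1 - 4 de, decay is obtained above height 1 - 2 de: the strip in between
    leaves room for the smaller rectangles, which hang below their points. The ratio 5 / de between
    consecutive sizes serves this and the engulfing of neighbours. The estimate on R^-(sigma) is
    that on an upper part, for -f with time reversed. *)

Lemma finite_trivIset_measure (I : Type) (E : set I) (S : I -> set T)
    (Om : set T) (a : R) :
  (0 < a)%R -> measurable Om -> mu Om < +oo -> trivIset E S ->
  (forall i, E i -> [/\ measurable (S i), S i `<=` Om & a%:E <= mu (S i)]) ->
  finite_set E.
Proof.
move=> a0 mOm Omoo tE ES; apply: contrapT => /infiniteP/card_leP[h].
pose h' k := val (h (to_setT k)).
have Eh k : E (h' k) by exact: set_valP.
have hinj : injective h'.
  move=> i j /val_inj hij; have : to_setT i = to_setT j.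
    by apply: (inj (f := h)) hij; rewrite inE.
  by case.
have hS N : (N%:R * a)%:E <= mu Om.
  apply: (@le_trans _ _ (mu (\bigcup_k S (h' k)))); last first.
    rewrite le_measure ?inE//.
    - by apply: bigcup_measurable => k _; have [] := ES _ (Eh k).
    - by apply: bigcup_sub => k _; have [] := ES _ (Eh k).
  rewrite measure_bigcup; last 2 first.
  - by move=> k _; have [] := ES _ (Eh k).
  - by move=> i j _ _ ij; apply: hinj; exact: tE ij.
  apply: le_trans (nneseries_lim_ge N _); last by move=> *; exact: measure_ge0.
  under eq_bigl do rewrite in_setT.
  apply: (@le_trans _ _ (\sum_(0 <= i < N) a%:E)).
    by rewrite sumEFin sumr_const_nat subn0 mulr_natl.
  by apply: lee_sum => k _; have [] := ES _ (Eh k).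
have vE : mu Om = (fine (mu Om))%:E by rewrite fineK// ge0_fin_numE.
have := hS (Num.truncn (fine (mu Om) / a)).+1; apply/negP; rewrite -ltNge vE.
by rewrite lte_fin -ltr_pdivrMr// truncnS_gt.
Qed.

(* Among the disjoint families [X] such that every [S i] meeting a member of [X]
   meets one of level at most [lev i], a maximal one meets every [S i]: otherwise
   add a missed [S i] of least level. *)
Lemma vitali_levels (I : pointedType) (Z : set I) (lev : I -> nat)
    (S : I -> set T) (Om : set T) :
  measurable Om -> mu Om < +oo ->
  (forall i, Z i -> [/\ measurable (S i), S i `<=` Om & 0 < mu (S i)]) ->
  exists (D : set nat) (h : nat -> I),
    [/\ (forall k, D k -> Z (h k)), trivIset D (S \o h) &
        forall i, Z i -> exists k, [/\ D k, (lev (h k) <= lev i)%N &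
          S i `&` S (h k) !=set0]].
Proof.
move=> mOm Omoo ZS.
pose P X := [/\ X `<=` Z, trivIset X S & forall i, Z i ->
  (exists2 j, X j & S i `&` S j !=set0) ->
  exists j, [/\ X j, (lev j <= lev i)%N & S i `&` S j !=set0]].
have [|E [[EZ tE Elev] Emax]] := @Zorn_bigcup _ P.
  move=> F FP totF; split.
  - by apply: bigcup_sub => X /FP[].
  - move=> i j [X FX Xi] [Y FY Yj].
    have [XY|YX] := totF _ _ FX FY.
      by have [_ + _] := FP _ FY; apply => //; exact: XY.
    by have [_ + _] := FP _ FX; apply => //; exact: YX.
  - move=> i Zi [j [X FX Xj] ij].
    have [_ _ /(_ _ Zi)] := FP _ FX.
    by case; [exists j|move=> k [Xk ki ik]; exists k; split => //; exists X].
have Emeet i : Z i -> exists2 j, E j & S i `&` S j !=set0.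
  move=> Zi; apply: contrapT => iE.
  pose Q k := `[< exists i, [/\ Z i, lev i = k &
     ~ exists2 j, E j & S i `&` S j !=set0] >].
  have exQ : exists k, Q k by exists (lev i); apply/asboolP; exists i.
  have [_ /asboolP[m [Zm <- mE]] mmin] := ex_minnP exQ.
  have mm : S m `&` S m !=set0.
    have [_ _] := ZS _ Zm; rewrite setIid.
    by apply: contraPP => /nonemptyPn ->; rewrite measure0 ltxx.
  apply: (Emax (E `|` [set m])).
    split; first exact: subsetUl.
    by move=> /(_ m (or_intror erefl)) Em; apply: mE; exists m.
  split.
  - by rewrite subUset; split => // _ ->.
  - move=> a b [Ea|->] [Eb|->] ab //; first exact: tE.
      by exfalso; apply: mE; exists a => //; rewrite setIC.
    by exfalso; apply: mE; exists b.
  - move=> a Za [b [Eb|->] ab].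
      have [|c [Ec ca ac]] := Elev _ Za; first by exists b.
      by exists c; split => //; left.
    have [aE|aE] := pselect (exists2 j, E j & S a `&` S j !=set0).
      by have [c [Ec ca ac]] := Elev _ Za aE; exists c; split => //; left.
    exists m; split => //; first by right.
    by apply: mmin; apply/asboolP; exists a.
have cE : countable E.
  rewrite (_ : E = \bigcup_k [set i | E i /\ (k.+1%:R^-1)%:E <= mu (S i)]).
    apply: bigcup_countable => // k _; apply: finite_set_countable.
    apply: (@finite_trivIset_measure _ _ S Om (k.+1%:R^-1)%R) => //.
    - by move=> i j [Ei _] [Ej _]; exact: tE.
    - by move=> i [Ei ki]; have [] := ZS _ (EZ _ Ei).
  apply/seteqP; split => [i Ei|i [k _ []]//].
  have [mS SOm S0] := ZS _ (EZ _ Ei).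
  have Soo : mu (S i) < +oo by apply: le_lt_trans Omoo; rewrite le_measure ?inE.
  have SE : mu (S i) = (fine (mu (S i)))%:E by rewrite fineK// ge0_fin_numE.
  move: S0; rewrite SE lte_fin => s0.
  exists (Num.truncn (fine (mu (S i)))^-1) => //; split=> //; rewrite SE lee_fin.
  by rewrite invf_ple ?posrE// ltW// truncnS_gt.
have [g ginj] := countable_injP _ cE.
have [h hK] : exists h : nat -> I, forall i, E i -> h (g i) = i.
  have /choice[h hP] : forall k, exists i, (exists2 j, E j & g j = k) ->
      E i /\ g i = k.
    move=> k; have [[j Ej jk]|jk] := pselect (exists2 j, E j & g j = k).
      by exists j.
    by exists point.
  exists h => i Ei; have [|Eh gh] := hP (g i); first by exists i.
  by apply: ginj; rewrite ?inE.
(* The family is indexed by integers through an injection [g] with left inverse [h], so that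
   measures of disjoint unions become series. *)
exists (g @` E), h; split.
- by move=> _ [i Ei <-]; rewrite hK//; exact: EZ.
- move=> _ _ [i Ei <-] [j Ej <-] /=; rewrite !hK// => ij.
  by congr g; exact: tE ij.
- move=> i Zi; have [j [Ej ji ij]] := Elev _ Zi (Emeet _ Zi).
  by exists (g j); split; [exists j|rewrite hK|rewrite hK].
Qed.

End vitali.

(** * Density along grids *)

Section spacetime_outer.
Context {R : realType} {n : nat}.
Local Notation mu := (@lebesgue_spacetime R n).
Local Open Scope ereal_scope.
Implicit Types A B : set ('rV[R]_n * R).

(** By definition the measure is an outer measure on all subsets; hence monotonicity and
    subadditivity below carry no measurability hypotheses. *)
Lemma lebesgue_spacetimeE :
  mu = (lebesgue_row n \x @lebesgue_measure R)^*%mu :> (set _ -> _).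
Proof. by []. Qed.

Lemma spacetime_ge0 A : 0 <= mu A. Proof. exact: mu_ext_ge0. Qed.

Lemma le_spacetime A B : A `<=` B -> mu A <= mu B.
Proof.
exact: (le_outer_measure (lebesgue_row n \x @lebesgue_measure R)^*%mu).
Qed.

Lemma spacetimeU A B : mu (A `|` B) <= mu A + mu B.
Proof. exact: (outer_measureU2 (lebesgue_row n \x @lebesgue_measure R)^*%mu). Qed.

Lemma spacetime_bigcup (D : set nat) (F : nat -> set ('rV[R]_n * R)) :
  mu (\bigcup_(k in D) F k) <= \sum_(0 <= k <oo | k \in D) mu (F k).
Proof.
rewrite bigcup_mkcond eseries_mkcond.
have := outer_measure_sigma_subadditive
  (lebesgue_row n \x @lebesgue_measure R)^*%mu
  (fun k => if k \in D then F k else set0).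
move=> /le_trans; apply; apply: lee_nneseries => [k _ _|k _].
  exact: spacetime_ge0.
by case: ifPn => // _; rewrite [X in X <= _]outer_measure0.
Qed.

Lemma borel_spacetime A : measurable A ->
  measurable (A : set (spacetime R n)).
Proof. by move=> mA; apply: sub_caratheodory; exact: sub_sigma_algebra. Qed.

Lemma spacetime_setID A B : measurable (A : set (spacetime R n)) ->
  mu B = mu (B `&` A) + mu (B `\` A).
Proof. by move=> /(_ B); rewrite -setDE. Qed.

Lemma spacetime_approx_borel A (eta : R) : (0 < eta)%R -> mu A < +oo ->
  exists B, [/\ measurable B, A `<=` B & mu B <= mu A + eta%:E].
Proof.
move=> eta0 Aoo.
have Afin : mu A \is a fin_num by rewrite ge0_fin_numE// spacetime_ge0.
have [_ [F [mF AF] <-]] := lb_ereal_inf_adherent eta0 Afin.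
move=> /ltW Feta.
exists (\bigcup_k F k); split => //; first exact: bigcupT_measurable.
apply: le_trans Feta; rewrite lebesgue_spacetimeE measurable_mu_extE//.
  by apply: measure_sigma_subadditive => //; exact: bigcupT_measurable.
exact: bigcupT_measurable.
Qed.

End spacetime_outer.


Section density.
Context {R : realType} {n : nat}.
Local Notation mu := (@lebesgue_spacetime R n).
Local Notation E := ('rV[R]_n * R)%type.
Variables (h w : nat -> R) (Om : set E).
Hypotheses (h_gt0 : forall k, (0 < h k)%R) (w_gt0 : forall k, (0 < w k)%R).
Hypotheses (h_cvg0 : h @ \oo --> (0 : R)%R) (w_cvg0 : w @ \oo --> (0 : R)%R).
Hypothesis mOm : measurable (Om : set (spacetime R n)).
Hypothesis Omoo : (mu Om < +oo)%E.

(** The meshes in space and time shrink independently and successive grids need not be nested, so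
    density is reached by approximation rather than by martingales. *)
Definition grid k (z : E) : 'rV[int]_n * int :=
  (\row_i Num.floor (z.1 ord0 i / h k), Num.floor (z.2 / w k)).

(** Demanded at all fine levels, not just at one: two sets can then be approximated on a common
    grid, although a cell need not be a union of finer cells. *)
Definition grid_approx (A : set E) := forall eta : R, 0 < eta ->
  exists k0, forall k, (k0 <= k)%N -> exists J : set ('rV[int]_n * int),
  (mu (((A `\` grid k @^-1` J) `|` (grid k @^-1` J `\` A)) `&` Om) <= eta%:E)%E.

Lemma grid_approxC A : grid_approx A -> grid_approx (~` A).
Proof.
move=> aA eta eta0; have [k0 k0P] := aA _ eta0; exists k0 => k /k0P[J AJ].
exists (~` J); apply: le_trans AJ; apply: le_spacetime.
apply: setSI => z [[/= zA zJ]|[/= zJ zA]].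
  by right; split => //; exact: contrapT.
by left; split => //; exact: contrapT.
Qed.

Lemma grid_approx0 : grid_approx set0.
Proof.
move=> eta eta0; exists 0%N => k _; exists set0.
rewrite (_ : _ `&` _ = set0) ?measure0 ?lee_fin ?ltW//.
by rewrite preimage_set0 setD0 setU0 set0I.
Qed.

Lemma grid_approxU A B : grid_approx A -> grid_approx B -> grid_approx (A `|` B).
Proof.
move=> aA aB eta eta0; have eta20 : 0 < eta / 2 by rewrite divr_gt0.
have [k0 k0P] := aA _ eta20; have [k1 k1P] := aB _ eta20.
exists (maxn k0 k1) => k; rewrite geq_max => /andP[/k0P[J AJ] /k1P[J' BJ']].
exists (J `|` J'); rewrite (splitr eta) EFinD.
apply: le_trans (leeD AJ BJ'); apply: le_trans (spacetimeU _ _).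
apply: le_spacetime => z [[[AB JJ]|[JJ AB]] zO].
  case: AB => [zA|zB].
    by left; split => //; left; split => // zJ; apply: JJ; left.
  by right; split => //; left; split => // zJ; apply: JJ; right.
case: JJ => zJ.
  by left; split => //; right; split => // zA; apply: AB; left.
by right; split => //; right; split => // zA; apply: AB; right.
Qed.

Lemma grid_approx_bigcup (A : nat -> set E) :
  (forall i, measurable (A i : set (spacetime R n))) ->
  (forall i, grid_approx (A i)) -> grid_approx (\bigcup_i A i).
Proof.
move=> mA aA eta eta0; have eta20 : 0 < eta / 2 by rewrite divr_gt0.
pose B N := \big[setU/set0]_(i < N) A i.
have mB N : measurable (B N : set (spacetime R n)) by exact: bigsetU_measurable.
have mU : measurable (\bigcup_i A i : set (spacetime R n)).
  exact: bigcupT_measurable.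
have : (mu \o (fun N => Om `&` (\bigcup_i A i `\` B N))) N @[N --> \oo] --> mu set0.
  rewrite (_ : set0 = \bigcap_N (Om `&` (\bigcup_i A i `\` B N))); last first.
    apply/esym; rewrite -subset0 => z zP.
    have [_ [[i _ Aiz] _]] := zP 0%N I.
    have [_ [_ +]] := zP i.+1 I; apply.
    by rewrite /B big_ord_recr; right.
  apply: nonincreasing_cvg_mu.
  - by apply: le_lt_trans Omoo; apply: le_spacetime; exact: subIsetl.
  - by move=> N; apply: measurableI => //; exact: measurableD.
  - apply: bigcapT_measurable => N; apply: measurableI => //.
    exact: measurableD.
  - move=> N M NM; apply/subsetPset; apply: setIS; apply: setDS.
    exact: subset_bigsetU.
rewrite measure0 => /fine_cvgP[fin0 /cvgrPdist_lt /(_ _ eta20) near0].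
have [N _ NP] : \forall N \near \oo,
    (mu (Om `&` (\bigcup_i A i `\` B N)) <= (eta / 2)%:E)%E.
  near=> N.
  have Nfin : mu (Om `&` (\bigcup_i A i `\` B N)) \is a fin_num.
    by near: N; exact: fin0.
  rewrite -(fineK Nfin) lee_fin.
  have : `|0 - fine (mu (Om `&` (\bigcup_i A i `\` B N)))| < eta / 2.
    by near: N; exact: near0.
  by rewrite sub0r normrN => /ltW; apply: le_trans; exact: ler_norm.
have aB : grid_approx (B N).
  rewrite /B; elim/big_ind : _ => //; first exact: grid_approx0.
  exact: grid_approxU.
have [k0 k0P] := aB _ eta20; exists k0 => k /k0P[J BJ]; exists J.
rewrite (splitr eta) EFinD; apply: le_trans (leeD BJ (NP _ (leqnn N))).
apply: le_trans (spacetimeU _ _); apply: le_spacetime => z [[[zU zJ]|[zJ zU]] zO].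
  have [zB|zB] := pselect (B N z); first by left; split => //; left.
  by right.
left; split => //; right; split => // zB; apply: zU.
by move: zB; rewrite /B -bigcup_mkord => -[i _ Aiz]; exists i.
Unshelve. all: by end_near. Qed.

(** Meant for a coordinate [phi], with [J k a] the cells strictly below the one of [a]. Rounding
    down costs at most one mesh [s k], so the error lies in a strip just below [a], and such strips
    shrink to the empty set. *)
Lemma grid_approx_ray (phi : E -> R) (s : nat -> R)
    (J : nat -> R -> set ('rV[int]_n * int)) a :
  measurable_fun [set: spacetime R n] (phi : spacetime R n -> R) ->
  (forall k, 0 < s k) -> s @ \oo --> (0 : R) ->
  (forall k, grid k @^-1` (J k a) =
     [set z | Num.floor (phi z / s k) < Num.floor (a / s k)]) ->
  grid_approx [set z | phi z < a].
Proof.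
move=> mphi s0 scvg JE eta eta0.
pose B N := Om `&` phi @^-1` `]a - N.+1%:R^-1, a[.
have mB N : measurable (B N : set (spacetime R n)).
  apply: measurableI => //; rewrite -[X in measurable X]setTI.
  by apply: mphi.
have : (mu \o B) N @[N --> \oo] --> mu set0.
  rewrite (_ : set0 = \bigcap_N B N); last first.
    apply/esym; rewrite -subset0 => z zP.
    have [_ /=] := zP 0%N I; rewrite in_itv/= => /andP[_ za].
    have d0 : 0 < a - phi z by rewrite subr_gt0.
    have [_ /=] := zP (Num.truncn (a - phi z)^-1) I; rewrite in_itv/= za andbT.
    rewrite ltrBlDl -ltrBlDr ltNge => /negP; apply.
    by rewrite invf_ple ?posrE// ltW// truncnS_gt.
  apply: nonincreasing_cvg_mu => //.
  - by apply: le_lt_trans Omoo; apply: le_spacetime; exact: subIsetl.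
  - exact: bigcapT_measurable.
  - move=> N M NM; apply/subsetPset; apply: setIS => z /=.
    rewrite !in_itv/= => /andP[za ->]; rewrite andbT.
    by apply: le_lt_trans za; rewrite lerD2l lerN2 lef_pV2 ?posrE// ler_nat.
rewrite measure0 => /fine_cvgP[fin0 /cvgrPdist_lt /(_ _ eta0) near0].
have [N _ NP] : \forall N \near \oo, (mu (B N) <= eta%:E)%E.
  near=> N.
  have Nfin : mu (B N) \is a fin_num by near: N; exact: fin0.
  rewrite -(fineK Nfin) lee_fin.
  have : `|0 - fine (mu (B N))| < eta by near: N; exact: near0.
  by rewrite sub0r normrN => /ltW; apply: le_trans; exact: ler_norm.
have N0 : 0 < N.+1%:R^-1 :> R by rewrite invr_gt0.
move/cvgrPdist_lt : scvg => /(_ _ N0)[k0 _ k0P]; exists k0 => k /k0P /=.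
rewrite sub0r normrN gtr0_norm// => skN; exists (J k a).
apply: le_trans (NP _ (leqnn N)); apply: le_spacetime => z [+ zO].
rewrite JE /= => -[[za /negP]|[+ /negP]]; rewrite -leNgt; last first.
  move=> fl az; exfalso; move: fl; apply/negP; rewrite -leNgt; apply: le_floor.
  by rewrite ler_pM2r ?invr_gt0// ltW.
move=> fl; split => //=; rewrite in_itv/= za andbT.
have /andP[_ fa] := floor_itv (a / s k).
have /andP[fz _] := floor_itv (phi z / s k).
have : a / s k < phi z / s k + 1.
  apply: lt_le_trans fa _; rewrite intrD lerD2r//.
  by apply: le_trans fz; rewrite ler_int.
rewrite ltr_pdivrMr// mulrDl mul1r divfK ?gt_eqF// => az.
by rewrite ltrBlDr (lt_trans az)// ltrD2l.
Unshelve. all: by end_near. Qed.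


Let G : set (set E) :=
  [set A | measurable (A : set ('rV[R]_n * measurableTypeR R)%type) /\
           grid_approx A].

Let sigma_algebra_G : sigma_algebra setT G.
Proof.
split.
- by split => //; exact: grid_approx0.
- move=> A [mA aA]; rewrite setTD; split; first exact: measurableC.
  exact: grid_approxC.
- move=> F GF; split; first by apply: bigcupT_measurable => k; have [] := GF k.
  apply: grid_approx_bigcup => k; last by have [] := GF k.
  by apply: borel_spacetime; have [] := GF k.
Qed.

Let measurable_G_ray (phi : E -> R) (s : nat -> R)
    (J : nat -> R -> set ('rV[int]_n * int)) :
  measurable_fun [set: ('rV[R]_n * measurableTypeR R)%type]
    (phi : ('rV[R]_n * measurableTypeR R)%type -> R) ->
  (forall k, 0 < s k) -> s @ \oo --> (0 : R) ->
  (forall k a, grid k @^-1` (J k a) =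
     [set z | Num.floor (phi z / s k) < Num.floor (a / s k)]) ->
  measurable_fun [set: g_sigma_algebraType G]
    (phi : g_sigma_algebraType G -> R).
Proof.
move=> mphi s0 scvg JE.
apply: (measurability _ (RGenInftyO.measurableE R)).
move=> _ [_ [a ->] <-].
rewrite setTI; apply: sub_sigma_algebra.
have -> : phi @^-1` `]-oo, a[ = [set z | phi z < a].
  by apply/seteqP; split => z /=; rewrite in_itv.
have mA : measurable ([set z | phi z < a] : set ('rV[R]_n * measurableTypeR R)%type).
  rewrite (_ : mkset _ = phi @^-1` `]-oo, a[%classic); last first.
    by apply/seteqP; split => z /=; rewrite in_itv.
  by rewrite -[X in measurable X]setTI; exact: mphi.
split => //; apply: (grid_approx_ray phi s J _ _ s0 scvg (JE^~ a)).
move=> _ Y mY; rewrite setTI; apply: borel_spacetime.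
by rewrite -[X in measurable X]setTI; exact: mphi.
Qed.

(** The Borel sets with [grid_approx] form a sigma-algebra making every coordinate measurable, so it
    contains the whole product sigma-algebra; this is read off from the measurability of the
    identity. *)
Lemma grid_approx_borel A :
  measurable (A : set ('rV[R]_n * measurableTypeR R)%type) -> grid_approx A.
Proof.
move=> mA; suff mid : measurable_fun [set: g_sigma_algebraType G]
    (id : g_sigma_algebraType G -> ('rV[R]_n * measurableTypeR R)%type).
  have := mid measurableT _ mA; rewrite setTI preimage_id.
  by rewrite /measurable/= sigma_algebra_id// => -[].
apply/measurable_fun_pairP; split.
  apply: measurable_fun_rowP => i.
  apply: (measurable_G_ray (fun z : E => z.1 ord0 i) h
      (fun k a => [set j : 'rV[int]_n * int |
        j.1 ord0 i < Num.floor (a / h k)])) => //.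
    apply: (@measurableT_comp _ _ _ _ _ _ (fun x : 'rV[R]_n => x ord0 i)).
      exact: measurable_coor.
    exact: measurable_fst.
  by move=> k a; apply/seteqP; split => z /=; rewrite mxE.
by apply: (measurable_G_ray (snd : E -> R) w
  (fun k a => [set j : 'rV[int]_n * int | j.2 < Num.floor (a / w k)])).
Qed.

Lemma grid_approx_spacetime A : measurable (A : set (spacetime R n)) ->
  (mu A < +oo)%E -> grid_approx A.
Proof.
move=> mA Aoo eta eta0; have eta20 : 0 < eta / 2 by rewrite divr_gt0.
have [B [mB AB BA]] := spacetime_approx_borel A _ eta20 Aoo.
have DBA : (mu (B `\` A) <= (eta / 2)%:E)%E.
  have Afin : mu A \is a fin_num by rewrite ge0_fin_numE// spacetime_ge0.
  move: BA; rewrite (spacetime_setID A B mA) setIC setIidl//.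
  by rewrite leeD2lE.
have [k0 k0P] := grid_approx_borel B mB _ eta20.
exists k0 => k /k0P[J BJ]; exists J; rewrite (splitr eta) EFinD.
apply: le_trans (leeD BJ DBA); apply: le_trans (spacetimeU _ _).
apply: le_spacetime => z [[[zA zJ]|[zJ zA]] zO].
  by left; split => //; left; split => //; exact: AB.
have [zB|zB] := pselect (B z); first by right.
by left; split => //; right.
Qed.

Definition cell k z : set E := [set z' | grid k z' = grid k z].

Lemma measurable_grid k (J : set ('rV[int]_n * int)) :
  measurable (grid k @^-1` J : set (spacetime R n)).
Proof.
have mfl (s : R) (a : int) : 0 < s ->
    measurable ([set x | Num.floor (x / s) = a] : set R).
  move=> s0; rewrite (_ : mkset _ = `[a%:~R * s, (a + 1)%:~R * s[%classic).
    exact: measurable_itv.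
  apply/seteqP; split => x /=; rewrite in_itv/= -ler_pdivlMr// -ltr_pdivrMr//.
    by move=> <-; exact: floor_itv.
  exact: floor_def.
rewrite (_ : _ @^-1` _ =
    \bigcup_j if j \in J then grid k @^-1` [set j] else set0); last first.
  apply/seteqP; split => [z Jz|z [j _]].
    by exists (grid k z) => //; rewrite mem_set.
  by case: ifPn => // /set_mem Jj /= ->.
apply: countable_bigcupT_measurable => // j.
case: ifPn => // _; apply: borel_spacetime.
rewrite (_ : _ @^-1` _ =
    [set x : 'rV[R]_n | forall i, Num.floor (x ord0 i / h k) = j.1 ord0 i] `*`
    [set t | Num.floor (t / w k) = j.2]).
  apply: measurableX; last exact: mfl.
  by apply: (measurable_row_box (fun i => mfl _ (j.1 ord0 i) (h_gt0 k))).
apply/seteqP; split => -[x t] /=.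
  by move=> <-; split => // i; rewrite mxE.
case: j => a b /= [xa <-]; congr (_, _).
by apply/rowP => i; rewrite mxE xa.
Qed.

(* [F] is approximated by a union [W] of cells; the cells of [W] meeting [F] are
   at most half filled by [F], which forces [mu F] to be of the order of the
   approximation error. *)
Lemma density_null (F : set E) : measurable (F : set (spacetime R n)) ->
  F `<=` Om ->
  (forall k z, F z -> cell k z `<=` Om /\
     (mu (F `&` cell k z) <= (2^-1)%:E * mu (cell k z))%E) ->
  mu F = 0%E.
Proof.
move=> mF FO Fcell; apply/eqP; rewrite eq_le spacetime_ge0 andbT.
apply/lee_addgt0Pr => eta eta0; rewrite add0e.
have eta20 : 0 < eta / 2 by rewrite divr_gt0.
have Foo : (mu F < +oo)%E by apply: le_lt_trans Omoo; exact: le_spacetime.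
have [k /(_ k (leqnn k)) [J FJ]] := grid_approx_spacetime F mF Foo _ eta20.
pose J' := J `&` grid k @` F; pose W := grid k @^-1` J'.
have mW : measurable (W : set (spacetime R n)) by exact: measurable_grid.
have WO : W `<=` Om.
  move=> z [_ [z' Fz' zz']]; apply: (Fcell k z' Fz').1.
  by rewrite /cell /=.
have FW : (mu (F `\` W) <= (eta / 2)%:E)%E.
  apply: le_trans FJ; apply: le_spacetime => z [Fz Wz]; split; last exact: FO.
  by left; split => // Jz; apply: Wz; split => //; exists z.
have WF : (mu (W `\` F) <= (eta / 2)%:E)%E.
  apply: le_trans FJ; apply: le_spacetime => z [Wz Fz].
  by split; [right; split => //; exact: Wz.1|exact: WO].
have half : (mu (F `&` W) <= (2^-1)%:E * mu W)%E.
  pose D := choice.pickle @` J'.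
  pose C i := [set z | choice.pickle (grid k z) = i].
  have WE : W = \bigcup_(i in D) C i.
    apply/seteqP; split => [z Wz|z [_ [j Jj <-]]].
      by exists (choice.pickle (grid k z)) => //; exists (grid k z).
    by rewrite /C /= => /(pcan_inj choice.pickleK) zj; rewrite /W /= zj.
  have mC i : measurable (C i : set (spacetime R n)).
    exact: (measurable_grid k (choice.pickle @^-1` [set i])).
  have tC : trivIset D C by move=> i j _ _ [z []]; rewrite /C /= => -> .
  rewrite {1}WE setI_bigcupr WE measure_bigcup//; last 2 first.
  - by move=> i _; exact: measurableI.
  - by apply: trivIset_setIl.
  rewrite [leRHS in (_ <= _ * leRHS)%E]measure_bigcup// -nneseriesZl//.
  apply: lee_nneseries => [i _ _|i]; first exact: spacetime_ge0.
  rewrite inE => -[j [_ [z Fz zj] <-]].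
  have -> : C (choice.pickle j) = cell k z.
    rewrite -zj; apply/seteqP; split => y; rewrite /C /cell /=.
      exact: (pcan_inj choice.pickleK).
    by move=> ->.
  by have [] := Fcell k z Fz.
have FWfin : mu (F `&` W) \is a fin_num.
  rewrite ge0_fin_numE ?spacetime_ge0//; apply: le_lt_trans Foo.
  by apply: le_spacetime; exact: subIsetl.
have WE : (mu W <= mu (F `&` W) + (eta / 2)%:E)%E.
  apply: le_trans (leeD (lexx _) WF); apply: le_trans (spacetimeU _ _).
  by apply: le_spacetime => z Wz; have [Fz|Fz] := pselect (F z); [left|right].
have FE : (mu F <= mu (F `&` W) + (eta / 2)%:E)%E.
  apply: le_trans (leeD (lexx _) FW); apply: le_trans (spacetimeU _ _).
  by apply: le_spacetime => z Fz; have [Wz|Wz] := pselect (W z); [left|right].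
apply: (le_trans FE).
(* With m the measure of [F] in [W], the bound m <= (m + eta/2) / 2 forces m <= eta/2, so [F] has
   measure at most [eta]. *)
have : (mu (F `&` W) <= (2^-1)%:E * (mu (F `&` W) + (eta / 2)%:E))%E.
  by apply: le_trans half _; rewrite lee_pmul2l.
rewrite -(fineK FWfin) -EFinD -EFinM !lee_fin; lra.
Qed.

End density.

Section cell_box.
Context {R : realType} {n : nat}.
Local Notation mu := (@lebesgue_spacetime R n).
Variables (h w : nat -> R).
Hypotheses (h_gt0 : forall k, 0 < h k) (w_gt0 : forall k, 0 < w k).

Let floor_box (a b : R) : 0 < b ->
  [set x : R | Num.floor (x / b) = Num.floor (a / b)] =
  `[(Num.floor (a / b))%:~R * b, (Num.floor (a / b) + 1)%:~R * b[%classic.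
Proof.
move=> b0; apply/seteqP; split => x /=;
    rewrite in_itv/= -ler_pdivlMr// -ltr_pdivrMr//.
  by move=> <-; exact: floor_itv.
exact: floor_def.
Qed.

Let floor_dist (a x b : R) : 0 < b ->
  Num.floor (x / b) = Num.floor (a / b) -> `|x - a| < b.
Proof.
move=> b0 xa.
have : [set x : R | Num.floor (x / b) = Num.floor (a / b)] x by [].
have : [set x : R | Num.floor (x / b) = Num.floor (a / b)] a by [].
rewrite floor_box//= !in_itv/= intrD mulrDl mul1r ltr_norml; lra.
Qed.

Lemma cell_dist k z z' : cell (n := n) h w k z z' ->
  (forall i, `|z'.1 ord0 i - z.1 ord0 i| <= h k) /\ `|z'.2 - z.2| < w k.
Proof.
move=> [/rowP zz tt]; split => [i|]; last exact: floor_dist.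
by have := zz i; rewrite !mxE => /floor_dist => /(_ (h_gt0 k))/ltW.
Qed.

Lemma mu_cell k z : mu (cell h w k z) = ((h k) ^+ n * w k)%:E.
Proof.
pose A i := [set x : R | Num.floor (x / h k) = Num.floor (z.1 ord0 i / h k)].
pose B := [set x : R | Num.floor (x / w k) = Num.floor (z.2 / w k)].
have AE i : A i = _ := floor_box _ _ (h_gt0 k).
have BE : B = _ := floor_box _ _ (w_gt0 k).
have mA i : measurable (A i) by rewrite AE; exact: measurable_itv.
have muA i : lebesgue_measure (A i) = (h k)%:E.
  rewrite AE lebesgue_measure_itv/= lte_fin intrD mulrDl mul1r ltrDl h_gt0.
  by rewrite -EFinB; congr (_%:E); ring.
have muB : lebesgue_measure B = (w k)%:E.
  rewrite BE lebesgue_measure_itv/= lte_fin intrD mulrDl mul1r ltrDl w_gt0.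
  by rewrite -EFinB; congr (_%:E); ring.
have -> : cell h w k z = [set x : 'rV[R]_n | forall i, A i (x ord0 i)] `*` B.
  apply/seteqP; split => -[x t].
    by move=> [/rowP xz tz]; split => // i; have := xz i; rewrite !mxE.
  move=> [/= xz tz]; rewrite /cell /= /grid tz; congr (_, _).
  by apply/rowP => i; rewrite !mxE; exact: xz.
rewrite lebesgue_spacetimeX//; last 2 first.
- exact: measurable_row_box.
- by rewrite BE; exact: measurable_itv.
rewrite lebesgue_row_box// muB EFinM; congr (_ * _)%E.
rewrite (eq_bigr (fun=> (h k)%:E)) => [|i _]; last exact: muA.
by rewrite prodEFin prodr_const card_ord.
Qed.

End cell_box.

(** * Parabolic rectangles *)

Section parts.
Context {R : realType} {n : nat}.
Variable p : R.
Local Notation mu := (@lebesgue_spacetime R n).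
Local Notation E := ('rV[R]_n * R)%type.
Implicit Types (x y : 'rV[R]_n) (s r a b : R) (e : bool).

(* With [a] and [b] among -1, g, -g, 1 these are R, R^+(g) and R^-(g); the flag
   [e] reverses time, so that upper and lower parts are treated at once. *)
Definition part e y s r a b : set E :=
  cube y r `*` [set t | s + a * r `^ p < (-1) ^+ e * t < s + b * r `^ p].

Lemma part_true y s r a b : part true y s r a b = part false y (- s) r (- b) (- a).
Proof.
rewrite /part; congr (_ `*` _); apply/seteqP; split => t /=;
  rewrite expr0 expr1 mul1r mulN1r; lra.
Qed.

Lemma cube_box y r :
  cube y r = [set x | forall i, `[y ord0 i - r, y ord0 i + r]%classic (x ord0 i)].
Proof.
apply/seteqP; split => x xy i; have := xy i; rewrite /= in_itv/= ler_norml; lra.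
Qed.

Lemma part_itv y s r a b : part false y s r a b =
  cube y r `*` `]s + a * r `^ p, s + b * r `^ p[%classic.
Proof.
by rewrite /part; congr (_ `*` _); apply/seteqP; split => t /=;
  rewrite expr0 mul1r in_itv.
Qed.

Lemma measurable_cube y r : measurable (cube y r).
Proof.
by rewrite cube_box; apply: (measurable_row_box (fun i => measurable_itv _)).
Qed.

Lemma measurable_part e y s r a b :
  measurable (part e y s r a b : set (spacetime R n)).
Proof.
wlog -> : e s a b / e = false => [H|].
  by case: e; [rewrite part_true|]; exact: H.
by rewrite part_itv; apply: borel_spacetime; apply: measurableX => //;
  exact: measurable_cube.
Qed.

Lemma lebesgue_row_cube y r : 0 <= r ->
  lebesgue_row n (cube y r) = ((2 * r) ^+ n)%:E.
Proof.
move=> r0; rewrite cube_box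
  (lebesgue_row_box (A := fun i => `[y ord0 i - r, y ord0 i + r]%classic))//.
rewrite (eq_bigr (fun=> (2 * r)%:E)) => [|i _].
  by rewrite prodEFin prodr_const card_ord.
rewrite lebesgue_measure_itv/= lte_fin; case: ifPn => rr.
  by rewrite -EFinD; congr (_%:E); ring.
by congr (_%:E); move: rr; rewrite -leNgt; lra.
Qed.

Lemma mu_part e y s r a b : 0 <= r -> a <= b ->
  mu (part e y s r a b) = ((2 * r) ^+ n * ((b - a) * r `^ p))%:E.
Proof.
move=> r0; wlog -> : e s a b / e = false => [H ab|ab].
  case: e; last exact: H.
  by rewrite part_true H ?lerN2//; congr (_%:E); ring.
rewrite part_itv lebesgue_spacetimeX//; last exact: measurable_cube.
rewrite lebesgue_row_cube// EFinM; congr (_ * _)%E.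
have tau0 := powR_ge0 r p.
rewrite lebesgue_measure_itv/= lte_fin; case: ifPn => [_|].
  by rewrite -EFinD; congr (_%:E); ring.
rewrite -leNgt => h; congr (_%:E); apply/eqP; rewrite eq_le; apply/andP; split.
  by rewrite mulr_ge0// subr_ge0.
by move: h; rewrite mulrBl; lra.
Qed.

Lemma mu_part_lty e y s r a b : 0 <= r -> a <= b -> (mu (part e y s r a b) < +oo)%E.
Proof. by move=> r0 ab; rewrite mu_part// ltry. Qed.

Lemma sub_cube y y' r r' :
  (forall i, `|y' ord0 i - y ord0 i| <= r' - r) -> cube y r `<=` cube y' r'.
Proof.
by move=> yy x xy i; have := xy i; have := yy i; rewrite !ler_norml; lra.
Qed.

Lemma sub_part e y s r a b y' s' r' a' b' :
  (forall i, `|y' ord0 i - y ord0 i| <= r' - r) ->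
  s' + a' * r' `^ p <= s + a * r `^ p -> s + b * r `^ p <= s' + b' * r' `^ p ->
  part e y s r a b `<=` part e y' s' r' a' b'.
Proof.
by move=> /sub_cube yy a'a bb' -[x t] [/yy xy /= ut]; split => //=; lra.
Qed.

End parts.

(** * Rectangles clamped into the ambient region *)

Section clamped.
Context {R : realType} {n : nat}.
Variables (p : R) (e : bool) (y : 'rV[R]_n) (l T de : R).
Hypotheses (p1 : 1 < p) (de0 : 0 < de) (de4 : 4 * de < 1).
Local Notation E := ('rV[R]_n * R)%type.
Implicit Types (z : E) (r : R).

(* The rectangle of side length [r] moved as little as possible so as to fit in
   [cube y l] and below time [T]. *)
Definition ctr z r : 'rV[R]_n :=
  \row_i Num.max (y ord0 i - l + r) (Num.min (z.1 ord0 i) (y ord0 i + l - r)).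

(** Before clamping, the point lies at relative height [1 - de], the middle of the strip from
    [1 - 2 * de] to [1], with margin de r^p either way. Clamping lowers the rectangle, so the point
    only moves up in the strip. *)
Definition ctime z r : R :=
  Num.min ((-1) ^+ e * z.2 - (1 - de) * r `^ p) (T - r `^ p).

Definition ambient : set E := cube y l `*` [set t | (-1) ^+ e * t < T].

Lemma ctr_sub z r i : r <= l -> `|y ord0 i - ctr z r ord0 i| <= l - r.
Proof.
move=> rl; rewrite mxE ler_norml.
by case: (leP (z.1 ord0 i) _) => h1; case: (leP (y ord0 i - l + r) _) => h2; lra.
Qed.

Lemma ctime_le z r : ctime z r + r `^ p <= T.
Proof. by rewrite -lerBrDr /ctime ge_min lexx orbT. Qed.

Lemma ctime_gt z r : 0 < r -> ambient z -> (-1) ^+ e * z.2 - r `^ p < ctime z r.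
Proof.
move=> r0 [_ /= zT]; have tau0 : 0 < r `^ p by rewrite powR_gt0.
have : 0 < de * r `^ p by rewrite mulr_gt0.
by rewrite /ctime lt_min; lra.
Qed.

Lemma near_part z z' r : 0 < r -> r <= l -> ambient z -> ambient z' ->
  (forall i, `|z'.1 ord0 i - z.1 ord0 i| <= r) ->
  `|(-1) ^+ e * z'.2 - (-1) ^+ e * z.2| < de * r `^ p ->
  part p e (ctr z r) (ctime z r) r (1 - 2 * de) 1 z'.
Proof.
move=> r0 rl [zy /= zT] [zy' /= zT'] zz; rewrite ltr_norml => tt.
have tau0 : 0 < r `^ p by rewrite powR_gt0.
have dt0 : 0 < de * r `^ p by rewrite mulr_gt0.
have dt4 : 4 * (de * r `^ p) < r `^ p by rewrite mulrA gtr_pMl.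
split => [i|].
  have := zy i; have := zy' i; have := zz i; rewrite mxE !ler_norml.
  by case: (leP (z.1 ord0 i) _) => h1; case: (leP (y ord0 i - l + r) _) => h2; lra.
rewrite /= /ctime !mulrBl -!mulrA.
by case: (leP _ (T - r `^ p)) => h; lra.
Qed.

(** Engulfing: each point is within 2r in space and 2r^p in time of a common point, so they are
    within 4r and 4r^p of each other. The enlarged rectangle tolerates La r and de (La r)^p >= 5r^p,
    which explains the value 5 / de. *)
Lemma meet_part La z z' r r' : 5 / de <= La -> 0 < r' -> r' <= r -> La * r <= l ->
  ambient z -> ambient z' ->
  part p e (ctr z r) (ctime z r) r (-1) 1 `&`
    part p e (ctr z' r') (ctime z' r') r' (-1) 1 !=set0 ->
  part p e (ctr z (La * r)) (ctime z (La * r)) (La * r) (1 - 2 * de) 1 z'.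
Proof.
move: (p1) (de0) (de4) => p1' de0' de4'.
have d20 : 20 * de < 5 by lra.
move=> Lade r'0 r'r Lal az az' [w [[wz wt] [wz' wt']]].
have r0 : 0 < r by apply: lt_le_trans r'0 r'r.
have La20 : 20 < La by apply: lt_le_trans Lade; rewrite ltr_pdivlMr.
have Lar : 20 * r < La * r by rewrite ltr_pM2r.
have rl : r <= l by lra.
have zself v q : 0 < q -> q <= l -> ambient v ->
    part p e (ctr v q) (ctime v q) q (1 - 2 * de) 1 v.
  move=> q0 ql av; apply: near_part => // [i|]; first by rewrite subrr normr0 ltW.
  by rewrite subrr normr0 mulr_gt0// powR_gt0.
have tau0 : 0 < r `^ p by rewrite powR_gt0.
have tau'0 : 0 < r' `^ p by rewrite powR_gt0.
have tt : r' `^ p <= r `^ p by apply: ge0_ler_powR; rewrite ?nnegrE; lra.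
have [zz zt] := zself _ _ r0 rl az.
have [zz' zt'] := zself _ _ r'0 (le_trans r'r rl) az'.
apply: near_part => //; first by lra.
  move=> i; have := zz i; have := zz' i; have := wz i; have := wz' i.
  by rewrite !ler_norml; lra.
rewrite powRM; [|lra|lra].
have dL : 5 <= de * La `^ p.
  apply: (@le_trans _ _ (de * La)); first by rewrite -ler_pdivrMl// mulrC.
  by rewrite ler_pM2l// -{1}[La]powRr1 ?ler_powR//; lra.
have : 5 * r `^ p <= de * La `^ p * r `^ p by rewrite ler_pM2r.
have d0 : 0 < de * r `^ p by rewrite mulr_gt0.
have d0' : 0 < de * r' `^ p by rewrite mulr_gt0.
have dt4 : 4 * (de * r `^ p) < r `^ p by rewrite mulrA gtr_pMl.
have dt4' : 4 * (de * r' `^ p) < r' `^ p by rewrite mulrA gtr_pMl.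
move: zt zt' wt wt'; rewrite /= ltr_norml !mulrBl -!mulrA; lra.
Qed.

End clamped.

(** * Exponential decay inside one rectangle *)

Section local_step.
Context {R : realType} {n : nat}.
Local Notation mu := (@lebesgue_spacetime R n).
Local Notation E := ('rV[R]_n * R)%type.
Variables (p de eps : R) (e : bool).

(* The time lag gamma is written 1 - 4 * de throughout. *)
Definition tail_control (Om : set E) (g : E -> R) (c : 'rV[R]_n -> R -> R -> R)
    (K : R) := forall y (s r : R), 0 < r -> part p e y s r (-1) 1 `<=` Om ->
  (mu (part p e y s r (1 - 4 * de) 1 `&` [set z | c y s r + K < g z]%R) <=
     eps%:E * mu (part p e y s r (1 - 4 * de) 1))%E /\
  (mu (part p e y s r (-1) (- (1 - 4 * de)) `&` [set z | g z < c y s r - K]%R) <=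
     eps%:E * mu (part p e y s r (-1) (- (1 - 4 * de))))%E.

Variables (Om : set E) (g : E -> R) (c : 'rV[R]_n -> R -> R -> R) (K : R).
Hypotheses (p_gt1 : 1 < p) (de_gt0 : 0 < de) (de_lt : 4 * de < 1).
Let La := 5 / de.
Hypotheses (eps_gt0 : 0 < eps) (epsn : eps * (8 * 2 ^+ n) <= 1).
Hypothesis epsLa : eps * (2 * (La ^+ n * La `^ p)) <= expR (-1).
Hypothesis mg : measurable_fun (Om : set (spacetime R n)) (g : spacetime R n -> R).
Hypothesis mOm : measurable (Om : set (spacetime R n)).
Hypothesis K_gt0 : 0 < K.
Hypothesis gc : tail_control Om g c K.

Lemma measurable_superlevel (A : set E) v :
  measurable (A : set (spacetime R n)) -> A `<=` Om ->
  measurable (A `&` [set z | v < g z] : set (spacetime R n)).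
Proof.
move=> mA AO; rewrite (_ : _ `&` _ = A `&` (Om `&` g @^-1` `]v, +oo[%classic)).
  by apply: measurableI => //; exact: mg.
apply/seteqP; split => z /= [Az]; rewrite in_itv/= andbT.
  by move=> vg; split => //; split => //; exact: AO.
by move=> [].
Qed.

Lemma La_gt20 : 20 < La.
Proof.
move: (de_lt) => d4; rewrite /La ltr_pdivlMr//; lra.
Qed.

(** This turns a large constant into a large set: outside a fraction [eps] of the lower part, [g] is
    at least [c y s r - K], which exceeds [v + K]. *)
Lemma lower_part_le y (s r v : R) : 0 < r -> part p e y s r (-1) 1 `<=` Om ->
  v + K < c y s r - K ->
  (mu (part p e y s r (-1) (- (1 - 4 * de))) <=
   2%:E * mu (part p e y s r (-1) (- (1 - 4 * de)) `&` [set z | v + K < g z]%R))%E.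
Proof.
move: (de_gt0) (de_lt) (eps_gt0) (epsn) => d0 d4 e0 en r0 PO vc.
have [_ le1] := gc _ _ _ r0 PO.
set S := part _ _ _ _ _ _ _ in le1 *.
pose vS := (2 * r) ^+ n * ((- (1 - 4 * de) - (-1)) * r `^ p).
have muS : mu S = vS%:E.
  by rewrite mu_part//; [rewrite ltW|lra].
have : (mu S <= eps%:E * mu S + mu (S `&` [set z | v + K < g z]%R))%E.
  apply: le_trans (leeD le1 (lexx _)); apply: le_trans (spacetimeU _ _).
  apply: le_spacetime => z Sz; have [gz|gz] := ltP (g z) (c y s r - K).
    by left.
  by right; split => //; exact: lt_le_trans gz.
have : (mu (S `&` [set z | v + K < g z]%R) <= mu S)%E.
  by apply: le_spacetime; exact: subIsetl.
have := spacetime_ge0 (S `&` [set z | v + K < g z]).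
rewrite muS.
have vS0 : 0 <= vS.
  by rewrite /vS !mulr_ge0 ?exprn_ge0 ?mulr_ge0 ?powR_ge0//; lra.
case: (mu _) => [m| |]//; rewrite -!EFinM -EFinD !lee_fin => m0 mv.
have : (eps * 8) * vS <= 1 * vS.
  rewrite ler_wpM2r//; apply: le_trans en; rewrite ler_pM2l//.
  by rewrite ler_peMr// exprn_ege1// ler1n.
lra.
Qed.

(* Here z is bad if some rectangle of the family shrinking to z has a constant
   exceeding c y s l + 2K. At the first bad level the previous rectangle is still
   good, so there the induction hypothesis applies; the lower part of the bad one
   lies in the upper part of the big rectangle, where g > c y s l + K is rare,
   whence a small total measure by the covering lemma. The remaining points with
   g > c y s l + 3K form a null set by density. *)
Lemma local_step y (s l lam th : R) : 0 < l -> part p e y s l (-1) 1 `<=` Om ->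
  K <= lam -> 0 <= th ->
  (forall y (s r : R), 0 < r -> part p e y s r (-1) 1 `<=` Om ->
    (mu (part p e y s r (1 - 2 * de) 1 `&` [set z | c y s r + lam < g z]%R) <=
      th%:E * mu (part p e y s r (-1) 1))%E) ->
  (mu (part p e y s l (1 - 2 * de) 1 `&` [set z | c y s l + (lam + 2 * K) < g z]%R) <=
   (expR (-1) * th)%:E * mu (part p e y s l (-1) 1))%E.
Proof.
move: (p_gt1) (de_gt0) (de_lt) (eps_gt0) (epsn) (K_gt0) => p1 d0 d4 e0 en K0.
move=> l0 PO Klam th0 IH.
have L20 := La_gt20; have L0 : 0 < La by lra.
have p_ge0 : 0 <= p by lra.
have l_ge0 : 0 <= l by exact: ltW.
have [le11 le22] : -1 <= 1 :> R /\ -2 <= 2 :> R by split; lra.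
have [lem lea] : -1 <= 1 - 4 * de /\ -1 <= 1 - 2 * de by split; lra.
have [leg leb] : 1 - 4 * de <= 1 /\ 1 - 4 * de <= 1 - 2 * de by split; lra.
have leS : -1 <= - (1 - 4 * de) by lra.
pose T := s + l `^ p; pose r k := l / La ^+ k; pose c0 := c y s l.
have r0 k : 0 < r k by rewrite divr_gt0// exprn_gt0.
have rS k : r k = La * r k.+1.
  by rewrite /r exprS invfM mulrCA mulVKf ?gt_eqF.
have rl k : r k <= l.
  rewrite /r ler_pdivrMr ?exprn_gt0//.
  by apply: ler_peMr; [exact: ltW|apply: exprn_ege1; lra].
have r_homo i j : (i <= j)%N -> r j <= r i.
  move=> ij; rewrite /r ler_pM2l// lef_pV2 ?posrE ?exprn_gt0//.
  by apply: ler_weXn2l => //; lra.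
have tauS k : La * r k.+1 `^ p <= r k `^ p.
  have LaP : La <= La `^ p by rewrite -{1}[La]powRr1 ?ler_powR//; lra.
  apply: (@le_trans _ _ (La `^ p * r k.+1 `^ p)).
    by rewrite ler_wpM2r ?powR_ge0.
  by rewrite -powRM -?rS//; [lra|exact: ltW].
have taul k : r k.+1 `^ p <= de * l `^ p.
  have : La * r k.+1 `^ p <= l `^ p.
    apply: le_trans (tauS k) _.
    by apply: ge0_ler_powR; rewrite ?nnegrE// ltW.
  rewrite /La mulrAC ler_pdivrMr// mulrC => tl.
  have := powR_ge0 (r k.+1) p; lra.
have tau_geom k : r k `^ p <= l `^ p * La^-1 ^+ k.
  elim: k => [|k IHk]; first by rewrite /r expr0 divr1 expr0 mulr1.
  rewrite exprSr mulrA ler_pdivlMr// mulrC.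
  exact: le_trans (tauS k) IHk.
pose amb : set E := ambient e y l T.
pose G := part p e y s l (1 - 2 * de) 1.
have Gamb : G `<=` amb.
  by move=> z [zy /= /andP[_ zt]]; split => //=; rewrite /T -[l `^ p]mul1r.
(* Level 0 stands for the big rectangle itself. *)
pose RV z k a b : set E := if k is k'.+1 then
  part p e (ctr y l z (r k)) (ctime p e T de z (r k)) (r k) a b
  else part p e y s l a b.
pose RC z k := if k is k'.+1 then
  c (ctr y l z (r k)) (ctime p e T de z (r k)) (r k) else c0.
pose P := part p e y s l (-1) 1.
pose Pu := part p e y s l (1 - 4 * de) 1.
have tl0 : 0 < l `^ p by rewrite powR_gt0.
have dtl : 0 < de * l `^ p by rewrite mulr_gt0.
(* Such a rectangle reaches less than 2 r^p <= 2 de l^p below its point, which lies above height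
   [1 - 2 * de]; hence it stays above [1 - 4 * de]. *)
have RVu z k : G z -> RV z k.+1 (-1) 1 `<=` Pu.
  move=> Gz; apply: sub_part => [i||]; first exact: ctr_sub.
  - have [_ /= /andP[uz _]] := Gz.
    have tk := taul k.
    have : (-1) ^+ e * z.2 - r k.+1 `^ p < ctime p e T de z (r k.+1).
      by apply: ctime_gt => //; exact: Gamb.
    by move: uz; lra.
  - by rewrite !mul1r -/T; exact: ctime_le.
have PuP : Pu `<=` P.
  apply: sub_part => [i||]; first by rewrite !subrr normr0.
    by rewrite lerD2l; apply: ler_wpM2r => //; exact: ltW.
  by [].
have GP : G `<=` P.
  apply: sub_part => [i||]; first by rewrite !subrr normr0.
    by rewrite lerD2l; apply: ler_wpM2r => //; exact: ltW.
  by [].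
have RVO z k : G z -> RV z k (-1) 1 `<=` Om.
  move=> Gz; case: k => [//|k]; apply: subset_trans PO.
  exact: subset_trans (RVu _ _ Gz) PuP.
have muRV z k a b : a <= b ->
    mu (RV z k a b) = ((2 * r k) ^+ n * ((b - a) * r k `^ p))%:E.
  move=> ab; case: k => [|k]; last by apply: mu_part => //; exact: ltW.
  have -> : r 0%N = l by rewrite /r expr0 divr1.
  by apply: mu_part => //; exact: ltW.
pose bad z k := c0 + 2 * K < RC z k.
have /choice[lev levP] : forall z, exists k, (exists k, bad z k) ->
    bad z k /\ forall j, bad z j -> (k <= j)%N.
  move=> z; have [zk|zk] := pselect (exists k, bad z k); last by exists 0%N.
  by have [k kz kmin] := ex_minnP zk; exists k.
(* Level 0 carries the constant [c0] itself, so every first bad level has a predecessor. *)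
have bad0 z : bad z 0%N = false by rewrite /bad /=; apply/negbTE; rewrite -leNgt; lra.
pose Z := [set z | G z /\ exists k, bad z k].
have levS z : Z z -> exists2 k, lev z = k.+1 & bad z k.+1 /\ ~~ bad z k.
  move=> [Gz /levP[]]; case: (lev z) => [|k]; first by rewrite bad0.
  move=> bk kmin; exists k => //; split=> //; apply/negP => /kmin.
  by rewrite ltnn.
pose S z := RV z (lev z) (-1) (- (1 - 4 * de)).
have subRV z k : RV z k (-1) (- (1 - 4 * de)) `<=` RV z k (-1) 1.
  have rk q : 0 < q -> q * (- (1 - 4 * de)) <= q.
    by move=> q0; rewrite -[leRHS]mulr1 ler_wpM2l ?ltW//; lra.
  case: k => [|k]; apply: sub_part => [i||] //.
  - by rewrite !subrr normr0.
  - by rewrite lerD2l mulrC mul1r rk.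
  - by rewrite !subrr normr0.
  - by rewrite lerD2l mulrC mul1r rk// powR_gt0.
have mRV z k a b : measurable (RV z k a b : set (spacetime R n)).
  by case: k => [|k]; exact: measurable_part.
have [||z|D [h [hZ tD hD]]] :=
    @vitali_levels _ (spacetime R n) R mu _ Z lev S P.
- exact: measurable_part.
- by apply: mu_part_lty; [exact: ltW|lra].
- move=> Zz; have [k kE _] := levS _ Zz; split; first exact: mRV.
    rewrite /S kE; apply: subset_trans (subRV _ _) _.
    by apply: subset_trans (RVu _ _ Zz.1) PuP.
  suff : (0 < mu (S z))%E by [].
  rewrite /S muRV ?lte_fin; last by lra.
  apply: mulr_gt0; first by apply: exprn_gt0; exact: mulr_gt0.
  by apply: mulr_gt0; [lra|rewrite powR_gt0].
pose W k := RV (h k) (lev (h k)).-1.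
pose WG k := W k (1 - 2 * de) 1.
pose F := (G `&` [set z | c0 + 3 * K < g z]) `\` \bigcup_(k in D) WG k.
have F0 : mu F = 0%E.
  (* These meshes are exactly the tolerances of [near_part]: the points of [G] in the cell of z fall
     in the top strip of the clamped rectangle of z. *)
  pose hh k := r k.+1; pose ww k := de * r k.+1 `^ p.
  have hh0 k : 0 < hh k by exact: r0.
  have ww0 k : 0 < ww k by rewrite mulr_gt0// powR_gt0.
  have Lag : `|La^-1| < 1.
    rewrite ger0_norm ?invr_ge0 ?(ltW L0)// invf_lt1//.
    by apply: lt_trans L20; rewrite ltr1n.
  have hh_cvg : hh @ \oo --> (0 : R).
    rewrite (_ : hh = geometric (l / La) La^-1); first exact: cvg_geometric.
    by apply/funext => k; rewrite /hh /r /= exprS invfM exprVn mulrA.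
  have ww_cvg : ww @ \oo --> (0 : R).
    apply: (@squeeze_cvgr _ _ _ _ (fun=> 0) (geometric (de * l `^ p / La) La^-1)).
    - near=> k; apply/andP; split; first exact: ltW.
      rewrite /ww /geometric /= -!mulrA; apply: ler_wpM2l; first exact: ltW.
      by have := tau_geom k.+1; rewrite exprS.
    - exact: cvg_cst.
    - exact: cvg_geometric.
  have dtl4 : 4 * (de * l `^ p) < l `^ p by rewrite mulrA gtr_pMl.
  have wwl k : ww k <= de * l `^ p.
    have : ww k <= de * (de * l `^ p) by rewrite ler_wpM2l// ltW.
    have : de * (de * l `^ p) <= 4^-1 * (de * l `^ p).
      by rewrite ler_pM2r// -[leRHS]mul1r ler_pdivlMr// mulrC ltW.
    by move=> /[swap] /le_trans /[apply] /le_trans; apply; rewrite ler_piMl ?ltW// invf_lt1// ltr1n.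
  have cellP k z z' : cell hh ww k z z' ->
      (forall i, `|z'.1 ord0 i - z.1 ord0 i| <= hh k) /\
      `|(-1) ^+ e * z'.2 - (-1) ^+ e * z.2| < ww k.
    by move=> /(cell_dist _ _ hh0 ww0); rewrite -mulrBr normrMsign.
  (* Cells of points of [G] may stick out of [P]; the doubled rectangle contains them. *)
  pose Om' := part p e y s (2 * l) (-2) 2.
  have tl2 : l `^ p <= (2 * l) `^ p.
    apply: ge0_ler_powR; rewrite ?nnegrE ?mulr_ge0//.
    by rewrite ler_peMl// ler1n.
  apply: (density_null hh ww Om' hh0 ww0 hh_cvg ww_cvg).
  - exact: measurable_part.
  - by apply: mu_part_lty => //; exact: mulr_ge0.
  - apply: measurableD.
      apply: measurable_superlevel; first exact: measurable_part.
      exact: subset_trans GP PO.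
    by apply: bigcup_measurable => k _; exact: mRV.
  - move=> z [[Gz _] _]; move: Gz; apply: sub_part => [i||].
    + by rewrite subrr normr0; lra.
    + by move: tl2 dtl; lra.
    + by move: tl2 dtl; lra.
  move=> k z Fz; have [[Gz gz] nWz] := Fz.
  split.
    move=> z' /cellP[zz' tt']; have [zy /= /andP[t1 t2]] := Gz.
    split => [i|/=].
      have := zy i; have := zz' i; have := rl k.+1; rewrite -/(hh k) !ler_norml; lra.
    move: tt'; rewrite ltr_norml; have := wwl k; move: tl2 dtl; lra.
  (* Otherwise the lower part of z meets a selected one of no larger level, whose predecessor, [La]
     times bigger, engulfs z; if that predecessor is the big rectangle, z is in its strip [G]
     anyway. *)
  have nZ : ~ Z z.
    move=> Zz; have [j [Dj jz [w [wz wj]]]] := hD _ Zz.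
    apply: nWz; exists j => //; rewrite /WG /W.
    have [i iE _] := levS _ (hZ _ Dj); rewrite iE /=.
    have [q qE _] := levS _ Zz.
    case: i iE => [//|i] iE; rewrite /RV rS.
    apply: (meet_part p e y l T de p1 d0 d4 La (h j) z (r i.+2) (r q.+1)) => //.
    - by apply: r_homo; rewrite -qE -iE.
    - by rewrite -rS; exact: rl.
    - by apply: Gamb; exact: (hZ _ Dj).1.
    - exact: Gamb.
    - exists w; split.
        by move: wj; rewrite /S iE => /subRV.
      by move: wz; rewrite /S qE => /subRV.
  have nbad : RC z k.+1 <= c0 + 2 * K.
    by rewrite leNgt; apply/negP => bk; apply: nZ; split => //; exists k.+1.
  have tk0 : 0 < r k.+1 `^ p by rewrite powR_gt0.
  have := gc _ _ _ (r0 k.+1) (RVO z k.+1 Gz); move=> [+ _].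
  rewrite mu_part//; last exact: ltW.
  move=> gup.
  apply: le_trans (le_spacetime _ _ _) _; last first.
    apply: le_trans gup _; rewrite mu_cell// -!EFinM lee_fin.
    (* The upper part has 4 * 2^n times the volume of the cell, so [epsn] makes the exceptional set
       at most half a cell. *)
    pose A := hh k ^+ n * ww k.
    have A0 : 0 <= A by rewrite mulr_ge0 ?exprn_ge0 ?ltW.
    rewrite [leLHS](_ : _ = 2^-1 * (eps * (8 * 2 ^+ n) * A)); last first.
      by rewrite /A /hh /ww exprMn; field.
    rewrite ler_pM2l// -[leRHS]mul1r; exact: ler_wpM2r.
  move=> z' [[[Gz' gz'] _] /cellP[zz' tt']]; split => /=; last first.
    by move: nbad gz' => /=; lra.
  have : part p e (ctr y l z (r k.+1)) (ctime p e T de z (r k.+1)) (r k.+1) (1 - 2 * de) 1 z'.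
    by apply: near_part => //; exact: Gamb.
  apply: sub_part => [i||] //; first by rewrite !subrr normr0.
  by rewrite lerD2l; apply: ler_wpM2r => //; exact: ltW.
have IH' z j : G z -> (mu (RV z j (1 - 2 * de) 1 `&` [set z' | RC z j + lam < g z'])%R <=
    th%:E * mu (RV z j (-1) 1)%R)%E.
  by move=> /(RVO _ j); case: j => [|j]; exact: IH.
(* The predecessor is not bad, so its constant plus [lam] is at most [c0 + (lam + 2 * K)] and the
   induction hypothesis applies to it. Its volume is La^n La^p / (2 de) times that of the lower part
   of the bad rectangle, at least half of which has [g] above [c0 + K]. *)
have main k : D k -> (mu (WG k `&` [set z | c0 + (lam + 2 * K) < g z]%R) <=
   (th * (La ^+ n * La `^ p / de))%:E * mu (S (h k) `&` [set z | c0 + K < g z]%R))%E.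
  move=> Dk; have [Gz _] := hZ _ Dk; have [j jE [bj nbj]] := levS _ (hZ _ Dk).
  have low := lower_part_le _ _ _ c0 (r0 j.+1) (RVO (h k) j.+1 Gz) _.
  rewrite -leNgt in nbj; rewrite /bad in bj.
  have /low {}low : c0 + K < RC (h k) j.+1 - K by lra.
  apply: (@le_trans _ _ (mu (RV (h k) j (1 - 2 * de) 1 `&`
      [set z' | RC (h k) j + lam < g z'])%R)).
    rewrite /WG /W jE; apply: le_spacetime => z [Wz /= gz]; split => //=; lra.
  apply: le_trans (IH' _ _ Gz) _.
  have SE : S (h k) = RV (h k) j.+1 (-1) (- (1 - 4 * de)) by rewrite /S jE.
  pose C := La ^+ n * La `^ p / de.
  have C0 : 0 <= C by rewrite divr_ge0 ?mulr_ge0 ?exprn_ge0 ?powR_ge0 ?(ltW L0)// ltW.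
  apply: (@le_trans _ _ ((th * C / 2)%:E * mu (S (h k)))%E).
    rewrite SE !muRV// -!EFinM lee_fin rS powRM; [|exact: ltW..].
    rewrite [leLHS](_ : _ = th * C / 2 * ((2 * r j.+1) ^+ n *
      ((- (1 - 4 * de) - -1) * r j.+1 `^ p)))//.
    by rewrite /C !exprMn; field; rewrite gt_eqF.
  rewrite [leRHS](_ : _ = (th * C / 2)%:E *
    (2%:E * mu (S (h k) `&` [set z | c0 + K < g z]%R)))%E; last first.
    by rewrite muleA -EFinM divfK.
  apply: lee_wpmul2l; first by rewrite lee_fin divr_ge0// mulr_ge0.
  by rewrite SE.
apply: (@le_trans _ _ (mu (F `|` \bigcup_(k in D)
    (WG k `&` [set z | c0 + (lam + 2 * K) < g z])))).
  apply: le_spacetime => z [Gz]; rewrite /= -/c0 => gz.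
  have [[k Dk Wz]|Wz] := pselect ((\bigcup_(k in D) WG k) z).
    by right; exists k.
  by left; split => //; split => //=; lra.
apply: le_trans (spacetimeU _ _) _; rewrite F0 add0e.
apply: le_trans (spacetime_bigcup _ _) _.
apply: le_trans (lee_nneseries _ (fun k kD => main k (set_mem kD))) _.
  by move=> k _ _; exact: spacetime_ge0.
rewrite nneseriesZl; last by move=> k _; exact: spacetime_ge0.
rewrite -measure_bigcup; last 2 first.
- move=> k Dk; apply: measurable_superlevel; first exact: mRV.
  by apply: subset_trans (subRV _ _) _; apply: RVO; exact: (hZ _ Dk).1.
- by apply: trivIset_setIr.
have XPu : (mu (\bigcup_(k in D) (S (h k) `&` [set z | c0 + K < g z]%R)) <=
    eps%:E * mu Pu)%E.
  apply: le_trans (gc _ _ _ l0 PO).1; apply: le_spacetime.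
  apply: bigcup_sub => k Dk; apply: setSI.
  have [j jE _] := levS _ (hZ _ Dk).
  by rewrite /S jE; apply: subset_trans (subRV _ _) _; apply: RVu; exact: (hZ _ Dk).1.
apply: le_trans (lee_wpmul2l _ XPu) _.
  rewrite lee_fin mulr_ge0// divr_ge0 ?(ltW d0)//.
  by rewrite mulr_ge0 ?exprn_ge0 ?powR_ge0 ?(ltW L0).
rewrite !mu_part// -!EFinM lee_fin.
(* [Pu] is the fraction [2 * de] of [P]; this cancels the 1 / de of [main] and leaves the factor 2
   eps Q, at most [expR (-1)]. *)
pose Q := La ^+ n * La `^ p; pose A := (2 * l) ^+ n * l `^ p.
have A0 : 0 <= th * A by rewrite mulr_ge0// mulr_ge0 ?exprn_ge0 ?mulr_ge0 ?powR_ge0.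
rewrite [leLHS](_ : _ = 2 * (eps * (2 * Q) * (th * A))); last first.
  by rewrite /Q /A; field; rewrite gt_eqF.
rewrite [leRHS](_ : _ = 2 * (expR (-1) * (th * A))); last by rewrite /A; ring.
by rewrite ler_wpM2l// ler_wpM2r.
Unshelve. all: by end_near. Qed.

End local_step.

(** * Iteration, coverings and chains *)

Section decay.
Context {R : realType} {n : nat}.
Local Notation mu := (@lebesgue_spacetime R n).
Local Notation E := ('rV[R]_n * R)%type.
Variables (p de eps : R) (e : bool).
Variables (Om : set E) (g : E -> R) (c : 'rV[R]_n -> R -> R -> R) (K : R).
Hypotheses (p_gt1 : 1 < p) (de_gt0 : 0 < de) (de_lt : 4 * de < 1).
Let La := 5 / de.
Hypotheses (eps_gt0 : 0 < eps) (epsn : eps * (8 * 2 ^+ n) <= 1).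
Hypothesis epsLa : eps * (2 * (La ^+ n * La `^ p)) <= expR (-1).
Hypothesis mg : measurable_fun (Om : set (spacetime R n)) (g : spacetime R n -> R).
Hypothesis mOm : measurable (Om : set (spacetime R n)).
Hypothesis K_gt0 : 0 < K.
Hypothesis gc : tail_control p de eps e Om g c K.

(** Each [local_step] trades a height [2 * K] for a factor [expR (-1)]. The base case is plain
    inclusion; its offset [K] provides the hypothesis [K <= lam] of the step. *)
Lemma local_decay m y (s l : R) : 0 < l -> part p e y s l (-1) 1 `<=` Om ->
  (mu (part p e y s l (1 - 2 * de) 1 `&`
      [set z | c y s l + (2 * m%:R + 1) * K < g z]%R) <=
   (expR (- m%:R))%:E * mu (part p e y s l (-1) 1))%E.
Proof.
move: (de_gt0) (de_lt) (K_gt0) => d0 d4 K0.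
elim: m y s l => [|m IHm] y s l l0 PO.
  rewrite oppr0 expR0 mul1e; apply: le_spacetime => z [zG _]; move: z zG.
  apply: sub_part => [i||]; first by rewrite !subrr normr0.
    by rewrite lerD2l ler_wpM2r ?powR_ge0//; lra.
  by [].
rewrite (_ : - m.+1%:R = -1 + - m%:R :> R); last by rewrite -natr1 opprD addrC.
rewrite expRD (_ : (_ + 1) * K = (2 * m%:R + 1) * K + 2 * K); last first.
  by rewrite -natr1; ring.
apply: (local_step p de eps e Om) => //.
by rewrite mulrDl mul1r lerDr mulr_ge0 ?mulr_ge0// ltW.
Qed.

(** Vitali at a single size: disjoint rectangles of side [l / La] are selected so that the top
    strips of their enlargements to side [l] cover [A]; [local_decay] applies on each. Summing costs
    the volume ratio La^n La^p. *)
Lemma cover_decay (A : set E) y (L T l c0 : R) m : 0 < l -> l <= L ->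
  (mu Om < +oo)%E -> A `<=` ambient e y L T ->
  (forall z r, A z -> 0 < r -> r <= l ->
    part p e (ctr y L z r) (ctime p e T de z r) r (-1) 1 `<=` Om) ->
  (forall z, A z -> c (ctr y L z l) (ctime p e T de z l) l <= c0) ->
  (mu (A `&` [set z | c0 + (2 * m%:R + 1) * K < g z]%R) <=
   (expR (- m%:R) * (La ^+ n * La `^ p))%:E * mu Om)%E.
Proof.
move: (p_gt1) (de_gt0) (de_lt) (K_gt0) => p1 d0 d4 K0.
move=> l0 lL Omoo Aamb APO Ac0.
have L20 : 20 < La by rewrite /La ltr_pdivlMr//; lra.
have L0 : 0 < La by lra.
have [r1 [r0 rl lE]] : exists r1, [/\ 0 < r1, r1 <= l & l = La * r1].
  exists (l / La); split; last by rewrite mulrC divfK// gt_eqF.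
    by rewrite divr_gt0.
  by rewrite ler_pdivrMr// ler_pMr//; lra.
have tau0 : 0 < r1 `^ p by rewrite powR_gt0.
have le11 : -1 <= 1 :> R by lra.
pose U z r := part p e (ctr y L z r) (ctime p e T de z r) r.
pose S z := U z r1 (-1) 1.
have [z Az|D [h [hA tD hD]]] := @vitali_levels _ (spacetime R n) R mu _ A
    (fun=> 0%N) S Om mOm Omoo.
  split; first exact: measurable_part.
    exact: APO.
  suff : (0 < mu (S z))%E by [].
  rewrite /S mu_part ?lte_fin//; last exact: ltW.
  apply: mulr_gt0; first by apply: exprn_gt0; exact: mulr_gt0.
  by apply: mulr_gt0 => //; lra.
pose X k := U (h k) l (1 - 2 * de) 1 `&` [set z |
  c (ctr y L (h k) l) (ctime p e T de (h k) l) l + (2 * m%:R + 1) * K < g z].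
apply: (@le_trans _ _ (mu (\bigcup_(k in D) X k))).
  apply: le_spacetime => z [Az /= gz].
  have [k [Dk _ zk]] := hD _ Az.
  have Ahk := hA _ Dk; exists k => //; split => /=; last first.
    by apply: le_lt_trans gz; rewrite lerD2r; exact: Ac0.
  rewrite /U lE; apply: (meet_part _ _ _ _ _ _ p1 d0 d4 _ _ _ _ r1) => //.
  - by rewrite -lE.
  - exact: Aamb.
  - exact: Aamb.
  - by rewrite setIC.
apply: le_trans (spacetime_bigcup _ _) _.
pose C := expR (- m%:R) * (La ^+ n * La `^ p).
have XS k : k \in D -> (mu (X k) <= C%:E * mu (S (h k)))%E.
  move=> /set_mem/hA Ah.
  apply: le_trans (local_decay _ _ _ _ l0 (APO _ _ Ah l0 (lexx l))) _.
  rewrite /S /U !mu_part//; [|exact: ltW|exact: ltW].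
  rewrite -!EFinM lee_fin lE powRM; [|exact: ltW|exact: ltW].
  by rewrite /C !exprMn le_eqVlt; apply/orP; left; apply/eqP; ring.
apply: le_trans (lee_nneseries _ XS) _; first by move=> k _ _; exact: spacetime_ge0.
rewrite nneseriesZl; last by move=> k _; exact: spacetime_ge0.
rewrite -measure_bigcup//; last by move=> k _; exact: measurable_part.
apply: lee_wpmul2l.
  by rewrite lee_fin !mulr_ge0 ?expR_ge0 ?exprn_ge0 ?powR_ge0// ltW.
by apply: le_spacetime; apply: bigcup_sub => k /hA Ah; exact: APO.
Qed.

(* The upper part of the first rectangle and the lower part of the second one
   overlap in a fixed proportion, so some point there satisfies both bounds. *)
Lemma chain_step y (s : R) y' (s' r : R) : 0 < r ->
  part p e y s r (-1) 1 `<=` Om -> part p e y' s' r (-1) 1 `<=` Om ->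
  (forall i, `|y' ord0 i - y ord0 i| <= r) ->
  (2 - 4 * de) * r `^ p <= s' - s -> s' - s <= (2 - 2 * de) * r `^ p ->
  c y' s' r <= c y s r + 2 * K.
Proof.
move: (p_gt1) (de_gt0) (de_lt) (K_gt0) (eps_gt0) (epsn) => p1 d0 d4 K0 e0 en.
have [leg leS] : 1 - 4 * de <= 1 /\ -1 <= - (1 - 4 * de) by split; lra.
move=> r0; have r_ge0 := ltW r0.
move=> PO PO' yy ss1 ss2; rewrite leNgt; apply/negP => cc.
have tau0 : 0 < r `^ p by rewrite powR_gt0.
have r20 : 0 < r / 2 by rewrite divr_gt0.
have q0 : 0 < (r / 2) `^ p by rewrite powR_gt0.
have dt0 : 0 < de * r `^ p by rewrite mulr_gt0.
(* [B] occupies the times from s' - r^p to s + r^p over a cube around the midpoint of the centers;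
   dividing by [q] only serves to write it as a [part]. Its volume is at least 2 r^n de r^p, while
   the two exceptional sets total at most half of that. *)
pose q := (r / 2) `^ p.
pose B := part p e (2^-1 *: (y + y')) s (r / 2) ((s' - s - r `^ p) / q) (r `^ p / q).
have aq : (s' - s - r `^ p) / q * (r / 2) `^ p = s' - s - r `^ p.
  by rewrite divfK// gt_eqF.
have bq : r `^ p / q * (r / 2) `^ p = r `^ p by rewrite divfK// gt_eqF.
have BU : B `<=` part p e y s r (1 - 4 * de) 1.
  apply: sub_part; rewrite ?aq ?bq ?mul1r//; last by lra.
  by move=> i; rewrite !mxE; have := yy i; rewrite !ler_norml; lra.
have BU' : B `<=` part p e y' s' r (-1) (- (1 - 4 * de)).
  apply: sub_part; rewrite ?aq ?bq ?mul1r//; [|lra|lra].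
  by move=> i; rewrite !mxE; have := yy i; rewrite !ler_norml; lra.
have muB : (((r ^+ n) * (2 * (de * r `^ p)))%:E <= mu B)%E.
  rewrite mu_part; [|exact: ltW|]; last first.
    by rewrite ler_pM2r ?invr_gt0//; lra.
  rewrite lee_fin (_ : 2 * (r / 2) = r); last by field.
  rewrite mulrBl aq bq ler_wpM2l//.
    by rewrite exprn_ge0// ltW.
  by lra.
have : (mu B <= mu (part p e y s r (1 - 4 * de) 1 `&` [set z | c y s r + K < g z]%R)
    + mu (part p e y' s' r (-1) (- (1 - 4 * de)) `&` [set z | g z < c y' s' r - K]%R))%E.
  apply: le_trans (spacetimeU _ _); apply: le_spacetime => z Bz.
  have [gz|gz] := ltP (c y s r + K) (g z); first by left; split => //; exact: BU.
  right; split; first exact: BU'.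
  by rewrite /=; lra.
have [le1 _] := gc _ _ _ r0 PO; have [_ le2] := gc _ _ _ r0 PO'.
move=> /le_trans -/(_ _ (leeD le1 le2)) /(le_trans muB).
rewrite !mu_part// -!EFinM -EFinD lee_fin => H.
pose A := r ^+ n * (de * r `^ p).
have A0 : 0 < A by rewrite mulr_gt0// exprn_gt0.
have : 2 * A <= eps * (8 * 2 ^+ n) * A.
  move: H; rewrite !exprMn -/A => H.
  rewrite [leLHS](_ : _ = r ^+ n * (2 * (de * r `^ p))); last by rewrite /A; ring.
  by apply: le_trans H _; rewrite le_eqVlt; apply/orP; left; apply/eqP; rewrite /A; ring.
by rewrite ler_pM2r//; lra.
Qed.

Lemma chain m y (s : R) y' (s' r : R) : 0 < r -> (0 < m)%N ->
  (forall v, 0 <= v <= 1 ->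
    part p e (y + v *: (y' - y)) (s + v * (s' - s)) r (-1) 1 `<=` Om) ->
  (forall i, `|y' ord0 i - y ord0 i| <= m%:R * r) ->
  m%:R * ((2 - 4 * de) * r `^ p) <= s' - s ->
  s' - s <= m%:R * ((2 - 2 * de) * r `^ p) ->
  c y' s' r <= c y s r + 2 * m%:R * K.
Proof.
move=> r0 m0 PO yy ss1 ss2; have m0' : 0 < m%:R :> R by rewrite ltr0n.
pose Y j : 'rV[R]_n := y + (j%:R / m%:R) *: (y' - y).
pose S j : R := s + (j%:R / m%:R) * (s' - s).
have PYS j : (j <= m)%N -> part p e (Y j) (S j) r (-1) 1 `<=` Om.
  move=> jm; apply: PO; rewrite divr_ge0//= ler_pdivrMr// mul1r ler_nat//.
have step j : (j <= m)%N -> c (Y j) (S j) r <= c y s r + 2 * j%:R * K.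
  elim: j => [_|j IHj jm].
    by rewrite /Y /S mul0r scale0r mul0r !addr0 mulr0 mul0r addr0.
  apply: (@le_trans _ _ (c (Y j) (S j) r + 2 * K)); last first.
    have := IHj (ltnW jm); rewrite -natr1; lra.
  have SS : S j.+1 - S j = (s' - s) / m%:R.
    by rewrite /S -natr1; field; rewrite gt_eqF.
  apply: chain_step => //; [by apply: PYS; exact: ltnW|exact: PYS| | |].
  - move=> i; rewrite (_ : _ - _ = (y' ord0 i - y ord0 i) / m%:R); last first.
      by rewrite !mxE -natr1; field; rewrite gt_eqF.
    by rewrite normrM normfV (gtr0_norm m0') ler_pdivrMr// mulrC.
  - by rewrite SS ler_pdivlMr// mulrC.
  - by rewrite SS ler_pdivrMr// mulrC.
have := step m (leqnn m).
by rewrite /Y /S divff ?gt_eqF// scale1r mul1r (addrC y) subrK (addrC s) subrK.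
Qed.

End decay.

(** * Comparison of the upper and lower constants *)

(** In the last inequality 2 / th counts the steps of length th L that cross a distance 2L, 1 / de
    those that absorb a rounding error, and 1 the truncation. As p > 1, th^p / th tends to 0 with
    th. *)
Lemma small_scale (R : realType) (p de rho sigma : R) : 1 < p -> 0 < de ->
  -1 < rho -> -1 < sigma -> 0 < rho + sigma ->
  exists th, [/\ 0 < th, th <= 1, 2 * th `^ p <= 1 + rho,
    2 * th `^ p <= 1 + sigma &
    (1 + de^-1 + 2 / th) * (4 * th `^ p) <= rho + sigma].
Proof.
move=> p1 d0 rho1 sigma1 eta0.
have di0 : 0 < de^-1 by rewrite invr_gt0.
have D0 : 0 < 12 + 4 * de^-1 by lra.
(* The denominator collects 4 + 4 / de from the terms multiplied by th^p and 8 from the term in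
   th^(p-1); both powers will be at most [w]. *)
pose w := Num.min (Num.min 1 ((rho + sigma) / (12 + 4 * de^-1)))
  (Num.min ((1 + rho) / 2) ((1 + sigma) / 2)).
have [w0 w1 wr [ws we]] : [/\ 0 < w, w <= 1, 2 * w <= 1 + rho &
    2 * w <= 1 + sigma /\ w * (12 + 4 * de^-1) <= rho + sigma].
  have h1 : 0 < (1 + rho) / 2 by lra.
  have h2 : 0 < (1 + sigma) / 2 by lra.
  split; rewrite /w.
  - by rewrite !lt_min ltr01 divr_gt0//= h1 h2.
  - by rewrite !ge_min lexx.
  - by rewrite mulrC -ler_pdivlMr// !ge_min lexx !orbT.
  - split; first by rewrite mulrC -ler_pdivlMr// !ge_min lexx !orbT.
    by rewrite -ler_pdivlMr// !ge_min lexx !orbT.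
pose v := w `^ (p - 1)^-1.
have v0 : 0 < v by rewrite powR_gt0.
have vp : v `^ (p - 1) = w by rewrite -powRrM mulVf ?powRr1// ?ltW//; lra.
pose th := Num.min w v.
have th0 : 0 < th by rewrite lt_min w0.
have thw : th <= w by rewrite ge_min lexx.
have thp1 : th `^ (p - 1) <= w.
  rewrite -vp; apply: ge0_ler_powR; rewrite ?nnegrE; [lra|exact: ltW|exact: ltW|].
  by rewrite ge_min lexx orbT.
have thpE : th `^ p = th * th `^ (p - 1).
  rewrite {1}(_ : p = 1 + (p - 1)); last by rewrite addrC subrK.
  rewrite [LHS]powRD; last by rewrite (gt_eqF th0) implybT.
  by rewrite powRr1// ltW.
have thpw : th `^ p <= w.
  rewrite thpE; apply: le_trans thp1; rewrite ler_piMl ?powR_ge0//.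
  exact: le_trans thw w1.
exists th; split => //; [exact: le_trans w1|lra|lra|].
apply: le_trans we.
have -> : (1 + de^-1 + 2 / th) * (4 * th `^ p) =
    th `^ p * (4 + 4 * de^-1) + 8 * th `^ (p - 1).
  by rewrite thpE; field; rewrite !gt_eqF.
have : th `^ p * (4 + 4 * de^-1) <= w * (4 + 4 * de^-1).
  by rewrite ler_wpM2r//; lra.
lra.
Qed.

Lemma convex_itv (R : realDomainType) (a b u w v : R) :
  0 <= v <= 1 -> u <= a <= w -> u <= b <= w -> u <= a + v * (b - a) <= w.
Proof.
move=> /andP[v0 v1] /andP[ua aw] /andP[ub bw].
rewrite -subr_ge0 in v1; rewrite -subr_ge0 in ua; rewrite -subr_ge0 in ub.
rewrite -subr_ge0 in aw; rewrite -subr_ge0 in bw.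
have := mulr_ge0 v0 ub; have := mulr_ge0 v0 bw.
have := mulr_ge0 v1 ua; have := mulr_ge0 v1 aw; lra.
Qed.

Section two_sided.
Context {R : realType} {n : nat}.
Local Notation mu := (@lebesgue_spacetime R n).
Local Notation E := ('rV[R]_n * R)%type.
Variables (p de : R).
Hypotheses (p_gt1 : 1 < p) (de_gt0 : 0 < de) (de_lt : 4 * de < 1).

Lemma part_ambient e y (s L rho : R) :
  part p e y s L rho 1 `<=` @ambient R n e y L (s + L `^ p).
Proof.
by move=> z [zy /= /andP[_ zt]]; split => //=; rewrite -[L `^ p]mul1r.
Qed.

Lemma ctr_part_sub e y (s L rho r : R) (z : E) : part p e y s L rho 1 z ->
  0 < r -> r <= L -> 2 * r `^ p <= (1 + rho) * L `^ p ->
  part p e (ctr y L z r) (ctime p e (s + L `^ p) de z r) r (-1) 1 `<=`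
    part p e y s L (-1) 1.
Proof.
move: (p_gt1) (de_gt0) (de_lt) => p1 d0 d4 Pz r0 rL rr.
apply: sub_part => [i||]; first exact: ctr_sub.
  have [_ /= /andP[uz _]] := Pz.
  have : (-1) ^+ e * z.2 - r `^ p < ctime p e (s + L `^ p) de z r.
    by apply: ctime_gt => //; exact: part_ambient Pz.
  move: rr uz; lra.
by rewrite !mul1r; exact: ctime_le.
Qed.

(** Reversing time exchanges upper and lower parts, and changing sign exchanges the two tails; doing
    both preserves the condition, so only upper tails need treatment. *)
Lemma tail_control_reverse eps (Om : set E) (f : E -> R) c K :
  tail_control p de eps false Om f c K ->
  tail_control p de eps true Om (fun z => - f z) (fun y s r => - c y (- s) r) K.
Proof.
move=> fc y s r r0; rewrite !part_true !opprK => /(fc _ _ _ r0)[le1 le2]; split.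
  rewrite (_ : [set z | _] = [set z | f z < c y (- s) r - K])//.
  by apply/seteqP; split => z /=; lra.
rewrite (_ : [set z | _] = [set z | c y (- s) r + K < f z])//.
by apply/seteqP; split => z /=; lra.
Qed.

(* A straight chain of rectangles of side th * L joins the two centers: with m
   steps it covers a distance m * th * L in space and about m * (th * L)^p in
   time, and p > 1 leaves enough time when th is small. *)
Lemma upper_le_lower eps x (t L rho sigma th K : R) (f : E -> R) c (z w : E) :
  0 < eps -> eps * (8 * 2 ^+ n) <= 1 -> 0 < K -> 0 < L ->
  0 < th -> th <= 1 -> 2 * th `^ p <= 1 + rho -> 2 * th `^ p <= 1 + sigma ->
  (1 + de^-1 + 2 / th) * (4 * th `^ p) <= rho + sigma ->
  tail_control p de eps false (part p false x t L (-1) 1) f c K ->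
  part p false x t L rho 1 z -> part p true x (- t) L sigma 1 w ->
  c (ctr x L z (th * L)) (ctime p false (t + L `^ p) de z (th * L)) (th * L) <=
  c (ctr x L w (th * L)) (- ctime p true (- t + L `^ p) de w (th * L)) (th * L) +
    4 / th `^ p * K.
Proof.
move: (p_gt1) (de_gt0) (de_lt) => p1 d0 d4.
have [g0 g1 g2] : [/\ 0 < 2 - 4 * de, 1 <= 2 - 4 * de & 2 - 4 * de <= 2].
  by split; lra.
move=> e0 en K0 L0 th0 th1 thr ths thre fc Pz Pw.
set l := th * L; set s' := ctime _ false _ _ _ _; set s := ctime _ true _ _ _ _.
have l0 : 0 < l by rewrite mulr_gt0.
have lL : l <= L by rewrite ler_piMl// ltW.
have q0 : 0 < th `^ p by rewrite powR_gt0.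
have N0 : 0 < L `^ p by rewrite powR_gt0.
have tauE : l `^ p = th `^ p * L `^ p by rewrite powRM ?ltW.
have tau0 : 0 < l `^ p by rewrite powR_gt0.
have di0 : 0 < de^-1 by rewrite invr_gt0.
have ti0 : 0 < 2 / th by rewrite divr_gt0.
have q4 : 4 * th `^ p <= rho + sigma.
  by apply: le_trans thre; rewrite ler_pMl ?mulr_gt0//; lra.
have [_ /= /andP[uz _]] := Pz; have [_ /= /andP[uw _]] := Pw.
have s'l : (-1) ^+ false * z.2 - l `^ p < s'.
  by apply: ctime_gt => //; exact: part_ambient Pz.
have sl : (-1) ^+ true * w.2 - l `^ p < s.
  by apply: ctime_gt => //; exact: part_ambient Pw.
have s'u : s' + l `^ p <= t + L `^ p by exact: ctime_le.
have su : s + l `^ p <= - t + L `^ p by exact: ctime_le.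
have rq : 2 * l `^ p <= (1 + rho) * L `^ p by rewrite tauE mulrA ler_wpM2r// ltW.
have sq : 2 * l `^ p <= (1 + sigma) * L `^ p by rewrite tauE mulrA ler_wpM2r// ltW.
have e4 : 4 * l `^ p <= (rho + sigma) * L `^ p by rewrite tauE mulrA ler_wpM2r// ltW.
have sI : t - L `^ p + l `^ p <= - s <= t + L `^ p - l `^ p.
  by move: sl uw sq; lra.
have s'I : t - L `^ p + l `^ p <= s' <= t + L `^ p - l `^ p.
  by move: s'l uz rq; lra.
pose D := s' - (- s).
have Dlow : (rho + sigma) * L `^ p <= 2 * D.
  by move: uz uw s'l sl e4; rewrite /D; lra.
have Dup : D <= 2 * L `^ p by rewrite /D; lra.
pose b := (2 - 4 * de) * l `^ p.
have b0 : 0 < b by rewrite mulr_gt0.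
have bl : b <= 2 * l `^ p by rewrite /b ler_wpM2r ?powR_ge0.
have lb : l `^ p <= b by rewrite /b ler_peMl ?powR_ge0.
have D0 : 0 <= D by move: Dlow; have := mulr_gt0 (mulr_gt0 (ltr0n _ 4) q0) N0; nra.
(* As many steps of the minimal duration [b] as fit. The remainder, less than b <= 2 l^p, is spread
   over the steps, each of which can take 2 de l^p more; m de >= 1 suffices. *)
pose m := Num.truncn (D / b).
have [mD Dm] : m%:R <= D / b /\ D / b < m.+1%:R.
  by have := truncn_itv (divr_ge0 D0 (ltW b0)) => /andP[].
have mlow : de^-1 + 2 / th <= m%:R.
  suff : 1 + de^-1 + 2 / th <= D / b by move: Dm; rewrite -natr1; lra.
  rewrite ler_pdivlMr//.
  apply: (@le_trans _ _ ((1 + de^-1 + 2 / th) * (2 * l `^ p))).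
    by rewrite ler_wpM2l//; lra.
  have : (1 + de^-1 + 2 / th) * (4 * th `^ p) * L `^ p <= (rho + sigma) * L `^ p.
    by rewrite ler_wpM2r// ltW.
  rewrite -!mulrA -tauE; lra.
have mup : m%:R <= 2 / th `^ p.
  apply: le_trans mD _; rewrite ler_pdivrMr//; apply: le_trans Dup _.
  apply: (@le_trans _ _ (2 / th `^ p * l `^ p)).
    by rewrite tauE mulrA divfK ?gt_eqF.
  by rewrite ler_wpM2l// divr_ge0// ltW.
have m0 : (0 < m)%N by rewrite -(ltr0n R) (lt_le_trans _ mlow)// addr_gt0.
apply: (@le_trans _ _ (c (ctr x L w l) (- s) l + 2 * m%:R * K)); last first.
  rewrite lerD2l ler_wpM2r//; first exact: ltW.
  by rewrite (_ : 4 / _ = 2 * (2 / th `^ p)) ?ler_wpM2l// mulrA -natrM.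
apply: (chain p de eps false (part p false x t L (-1) 1)) => //.
- exact: fc.
- move=> v v01; have /andP[c1 c2] := convex_itv _ _ _ _ _ _ v01 sI s'I.
  apply: sub_part => [i||]; last 2 first.
  + by rewrite mulN1r mulN1r lerBrDr.
  + by rewrite !mul1r -lerBrDr.
  have := ctr_sub x L w l i lL; have := ctr_sub x L z l i lL.
  rewrite !ler_distlC !mxE -/(ctr _ _ _ _) => Bi Ai.
  exact: convex_itv.
- move=> i; have := ctr_sub x L w l i lL; have := ctr_sub x L z l i lL.
  have : 2 * L <= m%:R * l.
    have <- : 2 / th * l = 2 * L by rewrite /l mulrA divfK// gt_eqF.
    by rewrite ler_wpM2r ?(ltW l0)//; apply: le_trans mlow; rewrite lerDr ltW.
  rewrite !ler_norml; lra.
- by rewrite -ler_pdivlMr// -/b.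
- rewrite -/D; apply: (@le_trans _ _ ((m%:R + 1) * b)).
    by rewrite -ler_pdivrMr// natr1 ltW.
  have md : 1 <= m%:R * de by rewrite -ler_pdivrMr// div1r; lra.
  have : 1 * (2 * l `^ p) <= m%:R * de * (2 * l `^ p).
    by apply: ler_wpM2r => //; rewrite mulr_ge0// ltW.
  by move: bl; rewrite /b; lra.
Qed.

Lemma two_sided_decay eps x (t L rho sigma th K : R) (f : E -> R) c :
  let Om := part p false x t L (-1) 1 in
  let La := 5 / de in
  0 < eps -> eps * (8 * 2 ^+ n) <= 1 ->
  eps * (2 * (La ^+ n * La `^ p)) <= expR (-1) ->
  0 < K -> 0 < L -> -1 < rho < 1 -> -1 < sigma < 1 ->
  0 < th -> th <= 1 -> 2 * th `^ p <= 1 + rho -> 2 * th `^ p <= 1 + sigma ->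
  (1 + de^-1 + 2 / th) * (4 * th `^ p) <= rho + sigma ->
  measurable_fun (Om : set (spacetime R n)) (f : spacetime R n -> R) ->
  tail_control p de eps false Om f c K ->
  exists c0, forall m,
  (mu (part p false x t L rho 1 `&` [set z | c0 + (2 * m%:R + 1) * K < f z]%R) <=
    (expR (- m%:R) * (La ^+ n * La `^ p))%:E * mu Om)%E /\
  (mu (part p false x t L (-1) (- sigma) `&`
     [set z | f z < c0 - 4 / th `^ p * K - (2 * m%:R + 1) * K]%R) <=
    (expR (- m%:R) * (La ^+ n * La `^ p))%:E * mu Om)%E.
Proof.
move: (p_gt1) (de_gt0) (de_lt) => p1 d0 d4 Om La.
move=> e0 en eLa K0 L0 /andP[rho1 rho2] /andP[sig1 sig2] th0 th1 thr ths thre mf fc.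
set l := th * L.
have l0 : 0 < l by rewrite mulr_gt0.
have lL : l <= L by rewrite ler_piMl// ltW.
have N0 : 0 < L `^ p by rewrite powR_gt0.
have tauE : l `^ p = th `^ p * L `^ p by rewrite powRM ?ltW.
have small r v : 0 < r -> r <= l -> 2 * th `^ p <= 1 + v ->
    2 * r `^ p <= (1 + v) * L `^ p.
  move=> r0 rl thv; apply: (@le_trans _ _ (2 * l `^ p)).
    by rewrite ler_wpM2l//; apply: ge0_ler_powR; rewrite ?nnegrE; [lra|exact: ltW..|].
  by rewrite tauE mulrA ler_wpM2r// ltW.
have mOm : measurable (Om : set (spacetime R n)) by exact: measurable_part.
have Omoo : (mu Om < +oo)%E by apply: mu_part_lty; [exact: ltW|lra].
have OmE : Om = part p true x (- t) L (-1) 1 by rewrite part_true !opprK.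
pose Au := part p false x t L rho 1; pose Al := part p true x (- t) L sigma 1.
have AlE : part p false x t L (-1) (- sigma) = Al by rewrite /Al part_true opprK.
pose cu z := c (ctr x L z l) (ctime p false (t + L `^ p) de z l) l.
pose cl w := c (ctr x L w l) (- ctime p true (- t + L `^ p) de w l) l.
have ul z w : Au z -> Al w -> cu z <= cl w + 4 / th `^ p * K.
  move=> Az Aw; exact: (upper_le_lower eps x t L rho sigma th K f c z w
    e0 en K0 L0 th0 th1 thr ths thre fc Az Aw).
(* A sample point in each part, for the nonemptiness and the boundedness behind the supremum
   below. *)
have mid e s v : -1 < v -> v < 1 ->
    part p e x s L v 1 (x, (-1) ^+ e * (s + (1 + v) / 2 * L `^ p)).
  move=> v1 v2; split => [i|/=]; first by rewrite subrr normr0 ltW.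
  rewrite mulrA -signr_addb addbb expr0 !mul1r.
  have h1 : v * L `^ p < (1 + v) / 2 * L `^ p by rewrite ltr_pM2r//; lra.
  have h2 : (1 + v) / 2 * L `^ p < L `^ p by rewrite gtr_pMl//; lra.
  by rewrite !ltrD2l h1; lra.
have Au0 := mid false t rho rho1 rho2; have Al0 := mid true (- t) sigma sig1 sig2.
pose c0 := sup (cu @` Au).
have c0_ub z : Au z -> cu z <= c0.
  move=> Az; apply: ub_le_sup; last by exists z.
  by eexists => _ [z' Az' <-]; exact: ul Az' Al0.
have c0_lb w : Al w -> c0 <= cl w + 4 / th `^ p * K.
  move=> Aw; apply: ge_sup.
    exists (cu (x, (-1) ^+ false * (t + (1 + rho) / 2 * L `^ p))).
    by eexists; [exact: Au0|].
  by move=> _ [z Az <-]; exact: ul.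
exists c0 => m; split.
  apply: (cover_decay p de eps false Om f c K p1 d0 d4 e0 en eLa mf mOm K0 fc
    Au x L (t + L `^ p) l c0 m) => //; first exact: part_ambient.
  move=> z r Az r0 rl; exact: (ctr_part_sub false x t L rho r z Az r0
    (le_trans rl lL) (small _ _ r0 rl thr)).
rewrite AlE.
have fc' := tail_control_reverse _ _ _ _ _ fc.
have mf' : measurable_fun (Om : set (spacetime R n)) ((fun z => - f z) : spacetime R n -> R).
  exact: measurable_funN.
have -> : [set z | f z < c0 - 4 / th `^ p * K - (2 * m%:R + 1) * K] =
    [set z | 4 / th `^ p * K - c0 + (2 * m%:R + 1) * K < - f z].
  by apply/seteqP; split => z /=; lra.
apply: (cover_decay p de eps true Om _ _ K p1 d0 d4 e0 en eLa mf' mOm K0 fc'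
    Al x L (- t + L `^ p) l _ m) => //; first exact: part_ambient.
  move=> z r Az r0 rl; rewrite OmE; exact: (ctr_part_sub true x (- t) L sigma r z
    Az r0 (le_trans rl lL) (small _ _ r0 rl ths)).
by move=> w /c0_lb; rewrite /cl; lra.
Qed.

End two_sided.

(** * Parabolic BMO *)

(** Small [x] needs no decay, the right side being at least 1. Otherwise [m] is the largest index
    allowed, so m > (x / ka - s0 - 3) / 2, whence [(s0 + 3) / 2] in [A]; the extra [B] there pays
    for x^q <= 1 + x, valid as q <= 1. *)
Lemma decay_index (R : realType) (s0 ka D q x : R) : 0 <= s0 -> 0 < ka -> 1 <= D ->
  0 < q <= 1 -> 0 < x ->
  let B := (2 * ka)^-1 in
  let A := D * expR ((s0 + 3) / 2 + B) in
  1 <= A * expR (- B * x `^ q) \/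
  exists m : nat, s0 + (2 * m%:R + 1) <= x / ka /\
    D * expR (- m%:R) <= A * expR (- B * x `^ q).
Proof.
move=> s00 ka0 D1 /andP[q0 q1] x0 B A.
have B0 : 0 < B by rewrite invr_gt0 mulr_gt0.
have BxE : B * x = x / ka / 2 by rewrite /B invfM; ring.
rewrite /A; clearbody B => {A}.
have xq : x `^ q <= 1 + x.
  have [x1|x1] := leP x 1.
    apply: (@le_trans _ _ (1 `^ q)).
      by apply: ge0_ler_powR; rewrite ?nnegrE; [exact: ltW|exact: ltW|lra|].
    by rewrite powR1; lra.
  apply: (@le_trans _ _ (x `^ 1)); first by rewrite ler_powR// ltW.
  by rewrite powRr1; lra.
have Bxq : B * x `^ q <= B + B * x.
  by rewrite -[X in _ <= X + _]mulr1 -mulrDr ler_wpM2l// ltW.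
rewrite -mulrA -expRD.
have [xs|xs] := ltP (x / ka) (s0 + 1).
  left; rewrite -[leLHS]mul1r; apply: ler_pM => //.
  by rewrite -[leLHS]expR0 ler_expR mulNr; lra.
right; pose v := (x / ka - s0 - 1) / 2.
have v0 : 0 <= v by rewrite /v; lra.
have /andP[mv vm] := truncn_itv v0.
exists (Num.truncn v); move: vm; rewrite -natr1 => vm.
split; first by move: mv; rewrite /v; lra.
rewrite ler_wpM2l//; first by lra.
by rewrite ler_expR mulNr; move: vm; rewrite /v; lra.
Qed.

Section PBMO_tail.
Context {R : realType} {n : nat}.
Local Notation mu := (@lebesgue_spacetime R n).
Local Notation E := ('rV[R]_n * R)%type.
Variables (p : R).

Lemma prect_part (x : 'rV[R]_n) (t L : R) :
  prect p x t L = part p false x t L (-1) 1.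
Proof. by rewrite part_itv mulN1r mul1r. Qed.

Lemma prect_upper_part g (x : 'rV[R]_n) (t L : R) :
  prect_upper p g x t L = part p false x t L g 1.
Proof. by rewrite part_itv mul1r. Qed.

Lemma prect_lower_part g (x : 'rV[R]_n) (t L : R) :
  prect_lower p g x t L = part p false x t L (-1) (- g).
Proof. by rewrite part_itv mulN1r mulNr. Qed.

Lemma average_ge0 (D : set E) h : (forall z, 0 <= h z) -> (0 <= average D h)%E.
Proof.
move=> h0; apply: mule_ge0.
  by rewrite lee_fin invr_ge0 fine_ge0// spacetime_ge0.
by apply: integral_ge0 => z _; rewrite lee_fin.
Qed.

Lemma average_chebyshev (D A : set E) h (a b M v : R) :
  measurable (D : set (spacetime R n)) -> mu D = v%:E -> 0 < v ->
  measurable_fun (D : set (spacetime R n)) (h : spacetime R n -> R) ->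
  (forall z, 0 <= h z) -> 0 < a -> (average D h <= M%:E)%E -> M <= b * a ->
  A `<=` D -> (forall z, A z -> a <= h z) -> (mu A <= b%:E * mu D)%E.
Proof.
move=> mD Dv v0 mh h0 a0 hM Mba AD Ah.
have : (a%:E * mu (D `&` [set z | a%:E <= `|(h z)%:E|]%E) <=
    \int[mu]_(z in D) `|(h z)%:E|)%E.
  have mEh : measurable_fun (D : set (spacetime R n)) (EFin \o h).
    exact/measurable_EFinP.
  exact: (@le_integral_comp_abse _ (spacetime R n) R mu D mD (EFin \o h) a id
    (@measurable_id _ _ _) (fun r r0 => r0) (fun x y _ _ xy => xy) mEh a0).
under eq_integral do rewrite gee0_abs ?lee_fin//.
move=> cheb.
have AI : (mu A <= mu (D `&` [set z | a%:E <= `|(h z)%:E|]%E))%E.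
  apply: le_spacetime => z Az; split; first exact: AD.
  by rewrite /= lee_fin ger0_norm//; exact: Ah.
have Afin : mu A \is a fin_num.
  rewrite ge0_fin_numE ?spacetime_ge0//; apply: le_lt_trans (ltry v).
  by rewrite -Dv; exact: le_spacetime.
have : (a%:E * mu A <= (v * M)%:E)%E.
  apply: (@le_trans _ _ (\int[mu]_(z in D) (h z)%:E)%E).
    by apply: le_trans cheb; apply: lee_wpmul2l => //; rewrite lee_fin ltW.
  move: hM; rewrite /average Dv /=.
  move=> /(lee_wpmul2l (_ : (0 <= v%:E)%E)); rewrite lee_fin => /(_ (ltW v0)).
  by rewrite muleA -EFinM divff ?gt_eqF// mul1e.
rewrite -(fineK Afin) Dv -!EFinM !lee_fin => H.
rewrite -(ler_pM2l a0); apply: le_trans H _.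
apply: (@le_trans _ _ (v * (b * a))); first by rewrite ler_pM2l.
by rewrite (_ : v * _ = a * (b * v))//; ring.
Qed.

Lemma PBMO_tail_control (gamma q eps K N : R) (f : E -> R) x t L :
  0 < q -> -1 < gamma < 1 -> 0 < N -> 0 < K -> (2 * N) `^ q <= eps * K `^ q ->
  measurable_fun (prect p x t L : set (spacetime R n)) (f : spacetime R n -> R) ->
  PBMO_norm p gamma q (prect p x t L) f = N%:E ->
  exists c, tail_control p ((1 - gamma) / 4) eps false
    (part p false x t L (-1) 1) f c K.
Proof.
move=> q0 /andP[g0 g1] N0 K0 KN mf fN.
have gE : 1 - 4 * ((1 - gamma) / 4) = gamma by field.
(* The infimum over constants need not be attained; as [0 < N], the strict bound N < 2N leaves room
   to choose one. *)
have osc y s r : 0 < r -> prect p y s r `<=` prect p x t L ->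
    exists c : R, (PBMO_osc p gamma q f y s r c < (2 * N)%:E)%E.
  move=> r0 yx.
  have : (ereal_inf (range (PBMO_osc p gamma q f y s r)) < (2 * N)%:E)%E.
    apply: (@le_lt_trans _ _ N%:E); last by rewrite lte_fin; lra.
    by rewrite -fN; apply: ereal_sup_ubound; exists (y, s, r).
  by move=> /ereal_inf_lt[_ [c _ <-] oc]; exists c.
have /choice[c cP] : forall P : 'rV[R]_n * R * R, exists c : R,
    0 < P.2 -> prect p P.1.1 P.1.2 P.2 `<=` prect p x t L ->
    (PBMO_osc p gamma q f P.1.1 P.1.2 P.2 c < (2 * N)%:E)%E.
  move=> [[y s] r] /=; have [H|H] := pselect (0 < r /\ prect p y s r `<=` prect p x t L).
    by have [c oc] := osc _ _ _ H.1 H.2; exists c.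
  by exists 0 => r0 yx; exfalso; apply: H.
exists (fun y s r => c (y, s, r)) => y s r r0; rewrite -!prect_part => yx.
have := cP (y, s, r) r0 yx => /=; set c0 := c (y, s, r) => osc0.
rewrite gE.
pose up z := (f \- cst c0)^\+ z `^ q; pose lo z := (f \- cst c0)^\- z `^ q.
have up0 z : 0 <= up z by exact: powR_ge0.
have lo0 z : 0 <= lo z by exact: powR_ge0.
have sum_le : (average (prect_upper p gamma y s r) up +
    average (prect_lower p gamma y s r) lo <= ((2 * N) `^ q)%:E)%E.
  rewrite leNgt; apply/negP => lt; move: osc0; apply/negP; rewrite -leNgt.
  have -> : (2 * N)%:E = (((2 * N) `^ q)%:E `^ q^-1)%E.
    by rewrite poweR_EFin -powRrM divff ?gt_eqF// powRr1//; lra.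
  apply: gt0_ler_poweR => //; [by rewrite invr_ge0 ltW| | |exact: ltW].
    by rewrite in_itv/= lee_fin powR_ge0 leey.
  by rewrite in_itv/= adde_ge0 ?average_ge0 ?leey.
have tau0 : 0 < r `^ p by rewrite powR_gt0.
have vol0 : 0 < (2 * r) ^+ n by rewrite exprn_gt0// mulr_gt0.
have mpart D : measurable (D : set (spacetime R n)) -> D `<=` prect p y s r ->
    measurable_fun (D : set (spacetime R n)) (up : spacetime R n -> R) /\
    measurable_fun (D : set (spacetime R n)) (lo : spacetime R n -> R).
  move=> mD DP.
  have mfc : measurable_fun (D : set (spacetime R n)) ((f \- cst c0) : spacetime R n -> R).
    apply: measurable_funB; last exact: measurable_cst.
    apply: measurable_funS mf => //; last exact: subset_trans yx.
    by rewrite prect_part; exact: measurable_part.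
  split.
    apply: (@measurableT_comp _ _ _ _ _ _ (fun u : R => u `^ q)).
      exact: measurable_powR.
    exact: measurable_funrpos.
  apply: (@measurableT_comp _ _ _ _ _ _ (fun u : R => u `^ q)).
    exact: measurable_powR.
  exact: measurable_funrneg.
have r00 := ltW r0; have Kq0 : 0 < K `^ q by rewrite powR_gt0.
have powK u : K < u -> K `^ q <= u `^ q.
  move=> Ku; apply: ge0_ler_powR; rewrite ?nnegrE ?(ltW q0) ?(ltW K0) ?(ltW Ku)//.
  exact: ltW (lt_trans K0 Ku).
have [mU mL] : measurable (part p false y s r gamma 1 : set (spacetime R n)) /\
    measurable (part p false y s r (-1) (- gamma) : set (spacetime R n)).
  by split; exact: measurable_part.
have UP : part p false y s r gamma 1 `<=` prect p y s r.
  rewrite prect_part; apply: sub_part => [i||//]; first by rewrite !subrr normr0.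
  by rewrite lerD2l ler_pM2r//; lra.
have LP : part p false y s r (-1) (- gamma) `<=` prect p y s r.
  rewrite prect_part; apply: sub_part => [i|//|]; first by rewrite !subrr normr0.
  by rewrite lerD2l ler_pM2r//; lra.
split.
- apply: (@average_chebyshev _ _ up (K `^ q) _ ((2 * N) `^ q)
    ((2 * r) ^+ n * ((1 - gamma) * r `^ p))) => //.
  + by rewrite mu_part// ltW.
  + by rewrite !mulr_gt0// subr_gt0.
  + exact: (mpart _ mU UP).1.
  + apply: le_trans sum_le; rewrite -prect_upper_part leeDl//; exact: average_ge0.
  + by move=> z [_ /= cK]; apply: powK; rewrite /funrpos /= lt_max; lra.
- apply: (@average_chebyshev _ _ lo (K `^ q) _ ((2 * N) `^ q)
    ((2 * r) ^+ n * ((- gamma - -1) * r `^ p))) => //.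
  + by rewrite mu_part//; lra.
  + by rewrite !mulr_gt0//; lra.
  + exact: (mpart _ mL LP).2.
  + apply: le_trans sum_le; rewrite -prect_lower_part leeDr//; exact: average_ge0.
  + by move=> z [_ /= cK]; apply: powK; rewrite /funrneg /= lt_max; lra.
Qed.

End PBMO_tail.

Theorem theorem4p1 (R : realType) (n : nat) (p q gamma rho sigma : R)
    (hn : (1 <= n)%N) (hp : 1 < p)
    (hgamma : 0 < gamma < 1) (hrho : -1 < rho <= gamma)
    (hsigma : - rho < sigma <= gamma) (hq : 0 < q <= 1) :
  exists A B : R, [/\ 0 < A, 0 < B &
    forall (x : 'rV[R]_n) (t L : R), 0 < L ->
    forall f : 'rV[R]_n * R -> R,
    PBMO p gamma q (prect p x t L) f ->
    let N := PBMO_norm p gamma q (prect p x t L) f in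
    (0 < N)%E ->
    exists c : R, forall lambda : R, 0 < lambda ->
      (lebesgue_spacetime (prect_upper p rho x t L `&`
          [set z | (lambda < (f \- cst c)^\+ z)%R]) <=
        (A * expR (- B * (lambda / fine N) `^ q))%:E *
        lebesgue_spacetime (prect_upper p rho x t L))%E /\
      (lebesgue_spacetime (prect_lower p sigma x t L `&`
          [set z | (lambda < (f \- cst c)^\- z)%R]) <=
        (A * expR (- B * (lambda / fine N) `^ q))%:E *
        lebesgue_spacetime (prect_lower p sigma x t L))%E].
Proof.
case/andP: hgamma => g0 g1; case/andP: hrho => rho1 rhog.
case/andP: hsigma => sig1 sigg; case/andP: (hq) => q0 q1.
have g11 : -1 < gamma < 1 by lra.
have r11 : -1 < rho < 1 by lra.
have s11 : -1 < sigma < 1 by lra.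
have [rl1 sl1 le11] : [/\ rho <= 1, -1 <= - sigma & -1 <= 1 :> R] by split; lra.
pose de := (1 - gamma) / 4.
have d0 : 0 < de by rewrite /de; lra.
have d4 : 4 * de < 1 by rewrite /de; lra.
pose La := 5 / de; pose Q := La ^+ n * La `^ p.
have La0 : 0 < La by rewrite divr_gt0.
have Q0 : 0 < Q by rewrite mulr_gt0 ?exprn_gt0 ?powR_gt0.
(* The reciprocal of a sum meets both smallness conditions at once. *)
pose eps := (8 * 2 ^+ n + 2 * Q * expR 1)^-1.
have n0 : 0 < 2 ^+ n :> R by rewrite exprn_gt0.
have Qe0 : 0 < 2 * Q * expR 1 by rewrite mulr_gt0 ?expR_gt0// mulr_gt0.
have e0 : 0 < eps by rewrite invr_gt0; lra.
have en : eps * (8 * 2 ^+ n) <= 1 by rewrite mulrC ler_pdivrMr; lra.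
have eQ : eps * (2 * Q) <= expR (-1).
  rewrite expRN -[leRHS]div1r ler_pdivlMr ?expR_gt0//.
  by rewrite -mulrA mulrC ler_pdivrMr; lra.
have [th [th0 th1 thr ths thre]] :
    exists th, [/\ 0 < th, th <= 1, 2 * th `^ p <= 1 + rho,
      2 * th `^ p <= 1 + sigma &
      (1 + de^-1 + 2 / th) * (4 * th `^ p) <= rho + sigma].
  by apply: small_scale => //; lra.
(* With K = ka N this gives eps K^q = (2N)^q, as Chebyshev's inequality requires; [s0] is the gap,
   in units of [K], between the base levels of the two estimates. *)
pose ka := 2 * (eps^-1) `^ q^-1; pose s0 := 4 / th `^ p.
have ei0 : 0 < eps^-1 by rewrite invr_gt0.
have ka0 : 0 < ka by rewrite mulr_gt0// powR_gt0.
have s00 : 0 <= s0 by rewrite divr_ge0// powR_ge0.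
(* [2 / (1 - rho)] and [2 / (1 - sigma)] are the volume ratios of the rectangle to its two parts;
   the added 1 ensures [1 <= D]. *)
pose D := Q * (2 / (1 - rho) + 2 / (1 - sigma)) + 1.
have r10 : 0 < 1 - rho by lra.
have s10 : 0 < 1 - sigma by lra.
have Dr : Q * (2 / (1 - rho)) <= D.
  rewrite /D mulrDr; have : 0 < Q * (2 / (1 - sigma)) by rewrite mulr_gt0// divr_gt0.
  lra.
have Ds : Q * (2 / (1 - sigma)) <= D.
  rewrite /D mulrDr; have : 0 < Q * (2 / (1 - rho)) by rewrite mulr_gt0// divr_gt0.
  lra.
have D1 : 1 <= D.
  rewrite /D lerDr; apply: mulr_ge0; first exact: ltW.
  by rewrite addr_ge0// divr_ge0// ltW.
exists (D * expR ((s0 + 3) / 2 + (2 * ka)^-1)), (2 * ka)^-1; split.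
- by rewrite mulr_gt0 ?expR_gt0// (lt_le_trans ltr01 D1).
- by rewrite invr_gt0 mulr_gt0.
move=> x t L L0 f [[mf _] Noo] N N0.
have Nfin : N \is a fin_num by rewrite ge0_fin_numE// ltW.
have NE : N = (fine N)%:E by rewrite fineK.
have fN0 : 0 < fine N by rewrite fine_gt0// N0.
set N' := fine N in fN0 NE *; pose K := ka * N'.
have K0 : 0 < K by rewrite mulr_gt0.
have KN : (2 * N') `^ q <= eps * K `^ q.
  rewrite /K /ka powRM ?(ltW fN0)// powRM ?mulr_ge0 ?powR_ge0 ?(ltW fN0)//.
  rewrite powRM ?powR_ge0// -powRrM mulVf ?gt_eqF// powRr1 ?(ltW ei0)//.
  by rewrite (_ : eps * _ = 2 `^ q * N' `^ q)//; field; rewrite gt_eqF.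
have mf' : measurable_fun (part p false x t L (-1) 1 : set (spacetime R n))
    (f : spacetime R n -> R) by rewrite -prect_part.
have [c fc] := PBMO_tail_control p gamma q eps K N' f x t L q0 g11 fN0 K0 KN mf NE.
have [c0 c0P] := two_sided_decay p de hp d0 d4 eps x t L rho sigma th K f c
  e0 en eQ K0 L0 r11 s11 th0 th1 thr ths thre mf' fc.
exists c0 => lambda l0.
have V0 : 0 < (2 * L) ^+ n * L `^ p by rewrite mulr_gt0 ?exprn_gt0 ?powR_gt0 ?mulr_gt0.
have lN0 : 0 < lambda / N' by rewrite divr_gt0.
have lK : lambda / N' / ka * K = lambda by rewrite /K; field; rewrite !gt_eqF.
rewrite prect_upper_part prect_lower_part.
have muP a b : a <= b -> lebesgue_spacetime (part p false x t L a b) =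
    ((b - a) * ((2 * L) ^+ n * L `^ p))%:E.
  by move=> ab; rewrite mu_part//; [congr (_%:E); ring|exact: ltW].
have fin (S P : set ('rV[R]_n * R)) (v k : R) : k <= D -> lebesgue_spacetime P = v%:E -> 0 <= v ->
  S `<=` P ->
  (forall m : nat, s0 + (2 * m%:R + 1) <= lambda / N' / ka ->
     (lebesgue_spacetime S <= (expR (- m%:R) * k * v)%:E)%E) ->
  (lebesgue_spacetime S <= (D * expR ((s0 + 3) / 2 + (2 * ka)^-1) *
      expR (- (2 * ka)^-1 * (lambda / N') `^ q))%:E * lebesgue_spacetime P)%E.
  move=> kD Pv v0 SP Sm.
  have [A1|[m [ms Am]]] := decay_index R s0 ka D q (lambda / N') s00 ka0 D1 hq lN0.
    apply: le_trans (le_spacetime _ _ SP) _; rewrite Pv -EFinM lee_fin.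
    by rewrite ler_peMl.
  apply: le_trans (Sm _ ms) _; rewrite Pv -EFinM lee_fin ler_wpM2r//.
  by apply: le_trans Am; rewrite mulrC ler_wpM2r// expR_ge0.
have lamK (m : nat) : s0 + (2 * m%:R + 1) <= lambda / N' / ka ->
    s0 * K + (2 * m%:R + 1) * K <= lambda.
  by move=> ms; rewrite -mulrDl -[leRHS]lK ler_pM2r.
have s0K : 0 <= s0 * K by rewrite mulr_ge0// ltW.
split.
- apply: (fin _ (part p false x t L rho 1)
    ((1 - rho) * ((2 * L) ^+ n * L `^ p)) (Q * (2 / (1 - rho)))) => //.
  + by rewrite muP.
  + by rewrite mulr_ge0// ltW.
  move=> m ms; have [cu _] := c0P m; apply: (le_trans _ (le_trans cu _)); last first.
    rewrite muP// -EFinM lee_fin le_eqVlt; apply/orP; left; apply/eqP.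
    by rewrite -/La -/Q; field; rewrite gt_eqF.
  apply: le_spacetime => z [zP] /=; rewrite /funrpos /= lt_max => fz; split => //=.
  case/orP: fz (lamK m ms) => [fz lm|fz _]; first by clear -fz lm s0K; lra.
  by clear -fz l0; lra.
- apply: (fin _ (part p false x t L (-1) (- sigma))
    ((1 - sigma) * ((2 * L) ^+ n * L `^ p)) (Q * (2 / (1 - sigma)))) => //.
  + by rewrite muP//; congr (_%:E); ring.
  + by rewrite mulr_ge0// ltW.
  move=> m ms; have [_ cl] := c0P m; apply: (le_trans _ (le_trans cl _)); last first.
    rewrite muP// -EFinM lee_fin le_eqVlt; apply/orP; left; apply/eqP.
    by rewrite -/La -/Q; field; rewrite gt_eqF.
  apply: le_spacetime => z [zP] /=; rewrite /funrneg /= lt_max => fz; split => //=.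
  rewrite -/s0; case/orP: fz (lamK m ms) => [fz lm|fz _].
    by clear -fz lm s0K; lra.
  by clear -fz l0; lra.
Qed.
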